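(* Assume: (i) $\varphi$ is continuous and bounded, with a constant $K>0$ such that $\|\varphi(y)\|_\infty\le K$ for all $y\in\mathcal X$; (ii) there is $C_{\min}>0$ with $\inf_{T\subseteq\{1,\dots,p\}}\inf_{\zeta>1}F(\zeta,T,H^* )\ge C_{\min}$; (iii) there is $B>0$ with $\|\theta^*\|_\infty\le B$. Suppose $s=O(1)$, $\lambda_1\asymp\sqrt{\frac{\log p}{n}}+\sqrt{\frac{\log p}{m}}+\frac{\log p}{m}$, $\lambda_1\asymp\lambda_2$ and $\lambda_1=o(1)$. Then $$\|\widehat\theta-\theta^*\|_1=O_p\left(s\left(\sqrt{\frac{\log p}{n}}+\sqrt{\frac{\log p}{m}}+\frac{\log p}{m}\right)\right)=o_p(1).$$
   Context: Model. $\mathcal X=\{1,\dots,r\}^d$ is a finite set and $\varphi=(\varphi_1,\dots,\varphi_p):\mathcal X\to\mathbb R^p$. For $\theta\in\mathbb R^p$ let $p(x\mid\theta)=e^{\theta^\top\varphi(x)}/C(\theta)$, $x\in\mathcal X$, with $C(\theta)=\sum_{x\in\mathcal X}e^{\theta^\top\varphi(x)}$. The true parameter is $\theta^*\in\mathbb R^p$, $s:=\|\theta^*\|_0$ is its number of nonzero entries, $x_1,\dots,x_n$ are i.i.d. from $p(\cdot\mid\theta^* )$, and $H^*:=\operatorname{Cov}_{\theta^*}(\varphi(X))$ with $X\sim p(\cdot\mid\theta^* )$. Simulated chain. $Y_1,\dots,Y_m$ is an irreducible, aperiodic Markov chain on $\mathcal X$ with transition kernel $P(y,x)$, initial distribution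 $q$ and stationary distribution $h$. Estimator. $\mathcal L_n^m(\theta)=-\frac1n\sum_{i=1}^n\theta^\top\varphi(x_i)+\log\Big(\frac1m\sum_{i=1}^m\frac{e^{\theta^\top\varphi(Y_i)}}{h(Y_i)}\Big)$ and $\widehat\theta=\arg\min_{\theta\in\mathbb R^p}\mathcal L_n^m(\theta)+\lambda_1\|\theta\|_1+\lambda_2\|\theta\|_2^2$, with tuning parameters $\lambda_1,\lambda_2>0$. Compatibility factor. For $T\subseteq\{1,\dots,p\}$, $\zeta>1$ let $\mathcal C(\zeta,T)=\{\theta\in\mathbb R^p:\|\theta_{T^c}\|_1\le\zeta\|\theta_T\|_1\}$, where $\theta_T$ is the subvector indexed by $T$; for a non-negative definite $p\times p$ matrix $\Sigma$, $F(\zeta,T,\Sigma)=\inf_{0\ne\theta\in\mathcal C(\zeta,T)}\frac{s\,\theta^\top\Sigma\theta}{\|\theta_T\|_1^2}$ (with $\inf\emptyset=+\infty$). Asymptotics are as $n\to\infty$, where $p$ and $m$ may depend on $n$ and $K,C_{\min},B$ are constants. $a_n\asymp b_n$ means $c\,b_n\le a_n\le c'b_n$ for all $n$ with constants $c,c'>0$; $O_p$, $o_p$ are the usual stochastic order symbols. *)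

(* Defs.v *)
From HB Require Import structures.
From mathcomp Require Import all_boot all_order all_algebra.
From mathcomp Require Import all_classical all_reals all_analysis.

Set Implicit Arguments.
Unset Strict Implicit.
Unset Printing Implicit Defensive.

Import Order.TTheory GRing.Theory Num.Theory.
Import numFieldNormedType.Exports.

Local Open Scope classical_set_scope.
Local Open Scope ring_scope.

(* The supremum norm is the library norm `|x| on 'cV[R]_p. *)
Section Vectors.
Context {R : realType} {p : nat}.

Definition dot (u v : 'cV[R]_p) : R := (u^T *m v) 0 0.

Definition l0norm (u : 'cV[R]_p) : nat := #|[set j | u j 0 != 0]%SET|.

Definition l1norm_on (T : {set 'I_p}) (u : 'cV[R]_p) : R :=
  \sum_(j in T) `|u j 0|.

Definition l1norm (u : 'cV[R]_p) : R := \sum_j `|u j 0|.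

Definition sql2norm (u : 'cV[R]_p) : R := \sum_j u j 0 ^+ 2.

End Vectors.

Section ExponentialFamily.
Context {R : realType} {X : finType} {p : nat}.
Variable phi : X -> 'cV[R]_p.

Definition norm_const (theta : 'cV[R]_p) : R :=
  \sum_(x : X) expR (dot theta (phi x)).

Definition model_pmf (theta : 'cV[R]_p) (x : X) : R :=
  expR (dot theta (phi x)) / norm_const theta.

Definition model_mean (theta : 'cV[R]_p) : 'cV[R]_p :=
  \sum_(x : X) model_pmf theta x *: phi x.

Definition model_cov (theta : 'cV[R]_p) : 'M[R]_p :=
  \sum_(x : X) model_pmf theta x *:
    ((phi x - model_mean theta) *m (phi x - model_mean theta)^T).

(* Samples are 0-based: only the first n (resp. m) entries are used. *)
Definition neg_loglik_mc (n m : nat) (h : X -> R) (xs ys : nat -> X)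
    (theta : 'cV[R]_p) : R :=
  - (n%:R^-1 * \sum_(i < n) dot theta (phi (xs i)))
  + ln (m%:R^-1 * \sum_(i < m) (expR (dot theta (phi (ys i))) / h (ys i))).

Definition penalized_loss (n m : nat) (h : X -> R) (lambda1 lambda2 : R)
    (xs ys : nat -> X) (theta : 'cV[R]_p) : R :=
  neg_loglik_mc n m h xs ys theta
  + lambda1 * l1norm theta + lambda2 * sql2norm theta.

End ExponentialFamily.

Definition is_argmin {R : realType} {V : Type} (f : V -> R) (v : V) : Prop :=
  forall u, f v <= f u.

Section Compatibility.
Context {R : realType} {p : nat}.

Definition cone (zeta : R) (T : {set 'I_p}) : set 'cV[R]_p :=
  [set theta | l1norm_on (~: T)%SET theta <= zeta * l1norm_on T theta].

(* No division by zero: a nonzero theta in the cone has theta_T != 0. *)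
Definition compat_factor (s : nat) (zeta : R) (T : {set 'I_p})
    (Sigma : 'M[R]_p) : \bar R :=
  ereal_inf [set (s%:R * dot theta (Sigma *m theta)
                  / l1norm_on T theta ^+ 2)%:E
            | theta in [set theta | theta != 0 /\ cone zeta T theta]].

End Compatibility.

Section Chains.
Context {R : realType} {X : finType}.

Definition distribution_on (q : X -> R) : Prop :=
  (forall x, 0 <= q x) /\ \sum_x q x = 1.

Definition transition_kernel (P : X -> X -> R) : Prop :=
  forall y, distribution_on (P y).

Definition stationary (P : X -> X -> R) (h : X -> R) : Prop :=
  distribution_on h /\ forall x, \sum_y h y * P y x = h x.

Fixpoint kernel_iter (P : X -> X -> R) (k : nat) (y x : X) : R :=
  if k is k'.+1 then \sum_z P y z * kernel_iter P k' z x else (y == x)%:R.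

Definition chain_irreducible (P : X -> X -> R) : Prop :=
  forall y x, exists k, 0 < kernel_iter P k y x.

(* gcd {k >= 1 | P^k(x,x) > 0} = 1, i.e. every common divisor is 1. *)
Definition chain_aperiodic (P : X -> X -> R) : Prop :=
  forall (x : X) (d : nat),
    (forall k, (0 < k)%N -> 0 < kernel_iter P k x x -> (d %| k)%N) -> d = 1%N.

End Chains.

Section Sampling.
Context {R : realType} {X : finType} {disp : measure_display}
  {Omega : measurableType disp}.
Variable Pr : probability Omega R.

Definition discrete_rv (Z : Omega -> X) : Prop :=
  forall a, measurable [set w | Z w = a].

Definition iid_sample (n : nat) (f : X -> R) (xs : nat -> Omega -> X) : Prop :=
  [/\ forall i, (i < n)%N -> discrete_rv (xs i),
      forall i, (i < n)%N -> forall a, Pr [set w | xs i w = a] = (f a)%:E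
    & forall A : 'I_n -> {set X},
        Pr [set w | forall i : 'I_n, xs i w \in A i] =
        (\prod_(i < n) Pr [set w | xs i w \in A i])%E].

(* The Markov property P(Y_k+1 = x | Y_0 = a_0, .., Y_k = a_k) = P(a_k, x),
   multiplied out so that conditioning on null events needs no convention. *)
Definition markov_chain (m : nat) (q : X -> R) (P : X -> X -> R)
    (ys : nat -> Omega -> X) : Prop :=
  [/\ forall i, (i < m)%N -> discrete_rv (ys i),
      (0 < m)%N -> forall a, Pr [set w | ys 0%N w = a] = (q a)%:E
    & forall k (a : nat -> X), (k.+1 < m)%N ->
        Pr [set w | forall i, (i <= k.+1)%N -> ys i w = a i] =
        (Pr [set w | forall i, (i <= k)%N -> ys i w = a i]
         * (P (a k) (a k.+1))%:E)%E].

End Sampling.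

Section StochasticOrders.
Context {R : realType} {disp : nat -> measure_display}
  {Omega : forall n, measurableType (disp n)}.
Variable Pr : forall n, probability (Omega n) R.

Definition bigOp (Z : forall n, Omega n -> R) (b : nat -> R) : Prop :=
  forall eps : R, 0 < eps -> exists2 M : R, 0 < M &
    \forall n \near \oo,
      (Pr n [set w | (M * `|b n| < `|Z n w|)%R] <= eps%:E)%E.

Definition littleop (Z : forall n, Omega n -> R) (b : nat -> R) : Prop :=
  forall delta : R, 0 < delta ->
    Pr n [set w | delta * `|b n| < `|Z n w| ] @[n --> \oo] --> 0%E.

End StochasticOrders.

(* For sequences indexed by a sample size n >= 1. *)
Definition asymp {R : realType} (a b : nat -> R) : Prop :=
  exists c c' : R, [/\ 0 < c, 0 < c' &
    forall n, (0 < n)%N -> c * b n <= a n <= c' * b n].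

Definition rate {R : realType} (p m n : nat) : R :=
  Num.sqrt (ln p%:R / n%:R) + Num.sqrt (ln p%:R / m%:R) + ln p%:R / m%:R.

(* Main.v *)
Require Import Defs.
From HB Require Import structures.
From mathcomp Require Import all_boot all_order all_algebra.
From mathcomp Require Import all_classical all_reals all_analysis.
From mathcomp Require Import ring lra.

(** The penalized loss depends on the two samples only through the empirical
frequencies of the states.  Along a displacement [u] with [K |u|_1 <= 1/2], the
reweighted log-partition function grows at least like its mean plus a fixed
multiple of [u^T H^* u], so that, when the frequencies are within [eps] of their
limits, comparing the loss at [theta^*] and at [theta^* + u] gives
[u^T H^* u <= 24 |u|_1 Gamma] with [Gamma = O(eps + lambda1 + lambda2)].  The
compatibility condition for [T = {1..p}] reads [Cmin |u|_1^2 <= s u^T H^* u],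
whence [|u|_1 <= 24 s Gamma / Cmin]; convexity along the segment from [theta^*]
to [thetahat] removes the restriction on [u].

Since the state space and the chain are fixed, Chebyshev's inequality suffices
for the frequencies: [1_x - h x = psi - P psi] is solvable (Poisson's equation),
which turns occupation counts into a martingale plus a bounded term and gives
second moments [O(m)]; i.i.d. data are the chain with constant kernel.  As
[lambda1 > 0] forces [p >= 2], both [1/sqrt n] and [1/sqrt m] are [O(rate)]. *)

Set Implicit Arguments.
Unset Strict Implicit.
Unset Printing Implicit Defensive.

Import Order.TTheory GRing.Theory Num.Theory.
Import numFieldNormedType.Exports.

Local Open Scope classical_set_scope.
Local Open Scope ring_scope.

(** * Log-Laplace transforms on a finite set *)

Section LogSumExp.
Context {R : realType} {X : finType}.
Implicit Types (f w v a b z : X -> R).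

Lemma sum_expR_gt0 w a : (forall x, 0 <= w x) -> 0 < \sum_x w x ->
  0 < \sum_x w x * expR (a x).
Proof.
move=> w0 ws; rewrite lt_neqAle sumr_ge0 ?andbT; last first.
  by move=> x _; rewrite mulr_ge0 ?expR_ge0.
apply: contraTN ws; rewrite eq_sym psumr_eq0; last first.
  by move=> x _; rewrite mulr_ge0 ?expR_ge0.
move=> /allP w_eq0; rewrite big1 ?ltxx// => x _.
have /eqP := w_eq0 x (mem_index_enum x).
by move=> /eqP; rewrite mulf_eq0 expR_eq0 orbF => /eqP.
Qed.

(** The tangent of exp at [z] lies below exp; averaging this at [x] and [y] cancels the linear
    term. *)
Lemma expR_convex (t x y : R) : 0 <= t <= 1 ->
  expR ((1 - t) * x + t * y) <= (1 - t) * expR x + t * expR y.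
Proof.
move=> /andP[t0 t1]; set z := _ + _.
have tangent u : expR z * (1 + (u - z)) <= expR u.
  have -> : expR u = expR z * expR (u - z) by rewrite -expRD addrC subrK.
  by rewrite ler_pM2l ?expR_gt0// expR_ge1Dx.
have s0 : 0 <= 1 - t by rewrite subr_ge0.
have := lerD (ler_wpM2l s0 (tangent x)) (ler_wpM2l t0 (tangent y)).
apply: le_trans; rewrite /z le_eqVlt; apply/orP; left; apply/eqP.
set e := expR _; ring.
Qed.

(** Hölder's inequality in logarithmic form: subtracting [A] and [B] normalizes both exponential
    sums to 1, and pointwise convexity of exp then bounds the mixed sum by 1. *)
Lemma lse_convex w a b (t : R) : (forall x, 0 <= w x) -> 0 < \sum_x w x ->
  0 <= t <= 1 ->
  ln (\sum_x w x * expR ((1 - t) * a x + t * b x)) <=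
  (1 - t) * ln (\sum_x w x * expR (a x)) + t * ln (\sum_x w x * expR (b x)).
Proof.
move=> w0 ws /andP[t0 t1].
have Ag0 := sum_expR_gt0 a w0 ws; have Bg0 := sum_expR_gt0 b w0 ws.
set A := ln (\sum_x w x * expR (a x)); set B := ln (\sum_x w x * expR (b x)).
have eA : expR A = \sum_x w x * expR (a x) by rewrite lnK.
have eB : expR B = \sum_x w x * expR (b x) by rewrite lnK.
move: A eA B eB => A eA B eB.
rewrite -ler_expR lnK ?posrE ?sum_expR_gt0//.
set C := (1 - t) * A + t * B.
have normalized : \sum_x w x * expR ((1 - t) * (a x - A) + t * (b x - B)) <= 1.
  apply: (@le_trans _ _ (\sum_x w x *
      ((1 - t) * expR (a x - A) + t * expR (b x - B)))).
    by apply: ler_sum => x _; rewrite ler_wpM2l// expR_convex ?t0.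
  have splitE x : w x * ((1 - t) * expR (a x - A) + t * expR (b x - B)) =
      (1 - t) / expR A * (w x * expR (a x)) + t / expR B * (w x * expR (b x)).
    by rewrite !expRD !expRN; ring.
  rewrite (eq_bigr _ (fun x _ => splitE x)) big_split/= -!mulr_sumr -eA -eB.
  by rewrite !mulfVK ?expR_eq0// subrK.
have shiftE x : w x * expR ((1 - t) * a x + t * b x) =
    expR C * (w x * expR ((1 - t) * (a x - A) + t * (b x - B))).
  rewrite mulrCA -expRD; congr (_ * expR _); rewrite /C; ring.
rewrite (eq_bigr _ (fun x _ => shiftE x)) -mulr_sumr.
by rewrite -[leRHS]mulr1 ler_pM2l ?expR_gt0.
Qed.

Definition mean f z : R := \sum_x f x * z x.
Definition var f z : R := \sum_x f x * (z x - mean f z) ^+ 2.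

Lemma var_ge0 f z : (forall x, 0 <= f x) -> 0 <= var f z.
Proof. by move=> f0; apply: sumr_ge0 => x _; rewrite mulr_ge0 ?sqr_ge0. Qed.

(** The two sides differ by [(mean f z - c) ^+ 2]. *)
Lemma var_le f z (c : R) : \sum_x f x = 1 ->
  var f z <= \sum_x f x * (z x - c) ^+ 2.
Proof.
move=> f1; rewrite -subr_ge0 -sumrB.
have eqx x : f x * (z x - c) ^+ 2 - f x * (z x - mean f z) ^+ 2 =
    (mean f z - c) * 2 * (f x * z x) - (mean f z ^+ 2 - c ^+ 2) * f x by ring.
rewrite (eq_bigr _ (fun x _ => eqx x)) sumrB -!mulr_sumr f1 -/(mean f z).
by apply: le_trans (sqr_ge0 (mean f z - c)) _; rewrite le_eqVlt; apply/orP; left; apply/eqP; ring.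
Qed.

(** Follows from exp(-y/2) >= 1 - y/2 and (1 + y)(1 - y/2) >= 1 on [0, 1]. *)
Lemma ln1D_ge_half (y : R) : 0 <= y <= 1 -> y / 2 <= ln (1 + y).
Proof.
move=> /andP[y0 y1]; rewrite -ler_expR lnK; last by rewrite posrE; lra.
have e0 := expR_gt0 (- (y / 2)); have e1 := expR_ge1Dx (- (y / 2)).
have -> : expR (y / 2) = (expR (- (y / 2)))^-1 by rewrite expRN invrK.
rewrite -div1r ler_pdivrMr//.
apply: (@le_trans _ _ ((1 + y) * (1 + - (y / 2)))); first by nra.
by rewrite ler_wpM2l//; lra.
Qed.

Lemma log_mgf_ge f z : distribution_on f -> (forall x, `|z x - mean f z| <= 1) ->
  mean f z + var f z / 8 <= ln (\sum_x f x * expR (z x)).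
Proof.
move=> [f0 f1] zb; set mu := mean f z.
(* The square of exp(y/2) >= 1 + y/2, whose right side is nonnegative for y >= -1. *)
have quad (y : R) : `|y| <= 1 -> 1 + y + y ^+ 2 / 4 <= expR y.
  rewrite ler_norml => /andP[y1 _].
  have -> : expR y = expR (y / 2) ^+ 2 by rewrite -expRM_natl; congr expR; lra.
  have := expR_ge1Dx (y / 2); set e := expR _ => he.
  by apply: (@le_trans _ _ ((1 + y / 2) ^+ 2)); [lra|rewrite ler_sqr ?nnegrE; lra].
have shiftE x : f x * expR (z x) = expR mu * (f x * expR (z x - mu)).
  by rewrite mulrCA -expRD; congr (_ * expR _); ring.
rewrite (eq_bigr _ (fun x _ => shiftE x)) -mulr_sumr.
have f01 : 0 < \sum_x f x by rewrite f1.
rewrite lnM ?posrE ?expR_gt0 ?sum_expR_gt0// expRK lerD2l.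
have v0 := var_ge0 z f0.
(* Keeps [var f z / 4] in the range of [ln1D_ge_half], which halves it to the 1/8 of the
   statement. *)
have v1 : var f z <= 1.
  rewrite -[leRHS]f1; apply: ler_sum => x _; rewrite ler_piMr//.
  by rewrite -real_normK ?num_real// expr_le1.
have sumE : \sum_x f x * (z x - mu) = 0.
  under eq_bigr do rewrite mulrBr.
  by rewrite sumrB -mulr_suml f1 mul1r subrr.
have : 1 + var f z / 4 <= \sum_x f x * expR (z x - mu).
  apply: (@le_trans _ _ (\sum_x f x * (1 + (z x - mu) + (z x - mu) ^+ 2 / 4))).
    rewrite (eq_bigr (fun x => f x + f x * (z x - mu)
      + f x * (z x - mu) ^+ 2 / 4)); last by move=> x _; ring.
    by rewrite !big_split/= f1 sumE addr0 -mulr_suml.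
  by apply: ler_sum => x _; rewrite ler_wpM2l// quad.
move=> le_sum; apply: le_trans (_ : ln (1 + var f z / 4) <= _); last first.
  by rewrite ler_ln// posrE ?sum_expR_gt0//; lra.
apply: le_trans (_ : var f z / 4 / 2 <= _); first lra.
by apply: ln1D_ge_half; lra.
Qed.

(* Reweighting by a [v] close to [1] moves the mean by [O(delta)] and, since
   the new weights dominate [f / 3], costs only a constant in the variance. *)
Lemma reweighted_log_mgf_ge f v z (delta b : R) : distribution_on f ->
  (forall x, `|v x - 1| <= delta) -> delta <= 1 / 2 ->
  (forall x, `|z x| <= b) -> b <= 1 / 2 ->
  mean f z - 4 * delta * b + var f z / 24 <=
  ln (\sum_x v x * f x * expR (z x)) - ln (\sum_x v x * f x).
Proof.
move=> [f0 f1] vd d2 zb b2; set V := \sum_x v x * f x.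
have vb x : 1 - delta <= v x <= 1 + delta.
  by have := vd x; rewrite ler_norml => /andP[? ?]; apply/andP; split; lra.
have d0 : 0 <= delta.
  have [x _|X0] := pickP (@predT X); first exact: le_trans (vd x).
  by move: f1; rewrite big_pred0// => /eqP; rewrite eq_sym oner_eq0.
have V_le : V <= 1 + delta.
  apply: le_trans (_ : \sum_x (1 + delta) * f x <= _); last first.
    by rewrite -mulr_sumr f1 mulr1.
  apply: ler_sum => x _.
  by rewrite ler_wpM2r//; case/andP: (vb x).
have V_ge : 1 - delta <= V.
  apply: le_trans (_ : \sum_x (1 - delta) * f x <= _).
    by rewrite -mulr_sumr f1 mulr1.
  apply: ler_sum => x _.
  by rewrite ler_wpM2r//; case/andP: (vb x).
have V0 : 0 < V by lra.
(* With normalized weights the difference of logarithms is one log-Laplace transform, and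
   [log_mgf_ge] applies because |z - mean g z| <= 2 b <= 1. *)
pose g x := v x * f x / V.
have g0 x : 0 <= g x.
  by rewrite divr_ge0 ?mulr_ge0//; [have := vb x; lra|lra].
have g1 : \sum_x g x = 1 by rewrite -mulr_suml divff ?gt_eqF.
have gd : distribution_on g by [].
have -> : ln (\sum_x v x * f x * expR (z x)) - ln V =
    ln (\sum_x g x * expR (z x)).
  rewrite -ln_div ?posrE//; first by rewrite mulr_suml; congr ln;
    apply: eq_bigr => x _; rewrite /g; ring.
  apply: sum_expR_gt0 => // x; rewrite mulr_ge0//; have := vb x; lra.
have b0 : 0 <= b.
  have [x _|X0] := pickP (@predT X); first exact: le_trans (zb x).
  by move: f1; rewrite big_pred0// => /eqP; rewrite eq_sym oner_eq0.
have gmean : `|mean g z| <= b.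
  apply: le_trans (ler_norm_sum _ _ _) _.
  rewrite -[leRHS]mul1r -g1 mulr_suml ler_sum// => x _.
  by rewrite normrM ger0_norm// ler_wpM2l.
apply: le_trans (log_mgf_ge gd _); last first.
  move=> x; apply: le_trans (ler_normB _ _) _.
  by have := zb x; lra.
(* [v x >= 1/2] and [V <= 3/2] give [g >= f / 3]; together with the 1/8 of [log_mgf_ge] this makes
   1/24. *)
have var_le3 : var f z / 3 <= var g z.
  apply: le_trans (_ : (\sum_x f x * (z x - mean g z) ^+ 2) / 3 <= _).
    by rewrite ler_pM2r ?invr_gt0// var_le.
  rewrite mulr_suml ler_sum// => x _; rewrite mulrAC ler_wpM2r ?sqr_ge0//.
  rewrite /g ler_pdivlMr// mulrAC -mulrA mulrC ler_wpM2r//.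
  have := vb x; lra.
have mean_diff : mean f z - mean g z <= 4 * delta * b.
  rewrite /mean -sumrB.
  apply: le_trans (_ : \sum_x f x * (4 * delta * b) <= _); last first.
    by rewrite -mulr_suml f1 mul1r.
  apply: ler_sum => x _.
  have -> : f x * z x - g x * z x = f x * ((1 - v x / V) * z x).
    by rewrite /g; ring.
  rewrite ler_wpM2l//; apply: le_trans (ler_norm _) _; rewrite normrM.
  rewrite ler_pM//.
  (* [V] and [v x] both lie within [delta] of 1 and [V >= 1/2], whence the factor 4. *)
  have -> : 1 - v x / V = (V - v x) / V by rewrite mulrBl divff ?gt_eqF.
  rewrite normrM normfV (gtr0_norm V0) ler_pdivrMr//.
  have : `|V - v x| <= 2 * delta by have := vb x; rewrite ler_norml; lra.
  by move=> /le_trans; apply; nra.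
lra.
Qed.

End LogSumExp.

(** * The penalized loss *)

Section VectorNorms.
Context {R : realType} {p : nat}.
Implicit Types u v : 'cV[R]_p.

Lemma dotE u v : dot u v = \sum_j u j 0 * v j 0.
Proof. by rewrite /dot mxE; apply: eq_bigr => j _; rewrite mxE. Qed.

Lemma dotDl u1 u2 v : dot (u1 + u2) v = dot u1 v + dot u2 v.
Proof. by rewrite /dot linearD/= mulmxDl mxE. Qed.

Lemma dotZl (t : R) u v : dot (t *: u) v = t * dot u v.
Proof. by rewrite /dot linearZ/= -scalemxAl mxE. Qed.

Lemma dot_suml (I : finType) (c : I -> R) (F : I -> 'cV[R]_p) u :
  dot u (\sum_i c i *: F i) = \sum_i c i * dot u (F i).
Proof.
rewrite /dot mulmx_sumr summxE; apply: eq_bigr => i _.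
by rewrite -scalemxAr mxE.
Qed.

Lemma coord_le_norm v j : `|v j 0| <= `|v|.
Proof.
rewrite [leRHS]mx_normrE.
exact: (le_bigmax _ (fun ij : 'I_p * 'I_1 => `|v ij.1 ij.2|) (j, 0)).
Qed.

Lemma norm_dot_le u v : `|dot u v| <= l1norm u * `|v|.
Proof.
rewrite dotE; apply: le_trans (ler_norm_sum _ _ _) _.
rewrite /l1norm mulr_suml; apply: ler_sum => j _.
by rewrite normrM ler_wpM2l// coord_le_norm.
Qed.

Lemma l1norm_ge0 u : 0 <= l1norm u.
Proof. exact: sumr_ge0. Qed.

Lemma l1normD u v : l1norm (u + v) <= l1norm u + l1norm v.
Proof. by rewrite -big_split/=; apply: ler_sum => j _; rewrite mxE ler_normD. Qed.

Lemma l1normZ (t : R) u : l1norm (t *: u) = `|t| * l1norm u.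
Proof. by rewrite mulr_sumr; apply: eq_bigr => j _; rewrite mxE normrM. Qed.

Lemma l1norm_eq0 u : (l1norm u == 0) = (u == 0).
Proof.
apply/eqP/eqP => [|->]; last by rewrite /l1norm big1// => j _; rewrite mxE normr0.
move=> /eqP; rewrite psumr_eq0// => /allP u0; apply/matrixP => j k.
rewrite (ord1 k) mxE; apply/eqP; rewrite -normr_eq0.
exact: (u0 j (mem_index_enum j)).
Qed.

Lemma sql2norm_ge0 u : 0 <= sql2norm u.
Proof. by apply: sumr_ge0 => j _; rewrite sqr_ge0. Qed.

Lemma sql2norm_eq0 u : (sql2norm u == 0) = (u == 0).
Proof.
apply/eqP/eqP => [|->]; last by rewrite /sql2norm big1// => j _; rewrite mxE expr0n.
move=> /eqP; rewrite psumr_eq0; last by move=> j _; rewrite sqr_ge0.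
move=> /allP u0; apply/matrixP => j k.
rewrite (ord1 k) mxE; apply/eqP; rewrite -sqrf_eq0.
exact: (u0 j (mem_index_enum j)).
Qed.

(** The subtracted term is the strong convexity of the ridge penalty, the source of uniqueness of
    the minimizer. *)
Lemma sql2norm_convex (t : R) u v :
  sql2norm ((1 - t) *: u + t *: v) =
  (1 - t) * sql2norm u + t * sql2norm v - t * (1 - t) * sql2norm (u - v).
Proof.
rewrite /sql2norm !mulr_sumr -big_split/= -sumrB; apply: eq_bigr => j _.
by rewrite !mxE; ring.
Qed.

(** Coordinatewise, a^2 - (a + b)^2 <= -2ab <= 2|a||b|. *)
Lemma sql2norm_decrease_le u v :
  sql2norm v - sql2norm (v + u) <= 2 * `|v| * l1norm u.
Proof.
rewrite /sql2norm /l1norm mulr_sumr -sumrB; apply: ler_sum => j _.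
rewrite mxE; have := coord_le_norm v j; set a := v j 0; set b := u j 0.
move=> ha; have hab := ler_norm (- (a * b)).
rewrite normrN normrM in hab.
have := ler_wpM2r (normr_ge0 b) ha; have := sqr_ge0 b; lra.
Qed.

End VectorNorms.

(** Links the quadratic form of the compatibility condition to the variance in the log-Laplace lower
    bound. *)
Lemma dot_model_cov {R : realType} {X : finType} {p : nat}
    (phi : X -> 'cV[R]_p) (theta u : 'cV[R]_p) :
  dot u (model_cov phi theta *m u) =
  var (model_pmf phi theta) (fun x => dot u (phi x)).
Proof.
have meanE : dot u (model_mean phi theta) =
    mean (model_pmf phi theta) (fun x => dot u (phi x)) by rewrite dot_suml.
rewrite /model_cov mulmx_suml.
under eq_bigr do rewrite -scalemxAl.
rewrite dot_suml; apply: eq_bigr => x _; rewrite -meanE; congr (_ * _).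
set c := model_mean phi theta.
have dB : dot u (phi x) - dot u c = dot u (phi x - c).
  by rewrite /dot mulmxBr !mxE.
rewrite dB /dot; set e := phi x - c.
rewrite -mulmxA mulmxA mxE big_ord1 expr2; congr (_ * _).
by rewrite !mxE; apply: eq_bigr => j _; rewrite !mxE mulrC.
Qed.

Lemma norm_const_gt0 {R : realType} {X : finType} {p : nat}
    (phi : X -> 'cV[R]_p) theta (x0 : X) : 0 < norm_const phi theta.
Proof.
rewrite /norm_const (bigD1 x0)//= ltr_pwDl ?expR_gt0//.
by apply: sumr_ge0 => x _; rewrite expR_ge0.
Qed.

Lemma model_pmf_distribution {R : realType} {X : finType} {p : nat}
    (phi : X -> 'cV[R]_p) theta (x0 : X) :
  distribution_on (model_pmf phi theta).
Proof.
have C0 := norm_const_gt0 phi theta x0; split.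
  by move=> x; rewrite divr_ge0 ?expR_ge0// ltW.
by rewrite -mulr_suml divff// gt_eqF.
Qed.

Section PenalizedLoss.
Context {R : realType} {X : finType} {p : nat}.
Variables (phi : X -> 'cV[R]_p) (f v : X -> R) (lambda1 lambda2 : R).

(* The penalized loss depends on the samples only through the empirical
   frequencies [f] of the data and the ratios [v] of the empirical frequencies
   of the simulated chain to its stationary distribution. *)
Definition freq_loss (theta : 'cV[R]_p) : R :=
  - mean f (fun x => dot theta (phi x))
  + ln (\sum_x v x * expR (dot theta (phi x)))
  + lambda1 * l1norm theta + lambda2 * sql2norm theta.

Hypotheses (lambda1_ge0 : 0 <= lambda1) (v_ge0 : forall x, 0 <= v x)
  (v_gt0 : 0 < \sum_x v x).

Lemma freq_loss_convex (t : R) (a b : 'cV[R]_p) : 0 <= t <= 1 ->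
  freq_loss ((1 - t) *: a + t *: b) <=
  (1 - t) * freq_loss a + t * freq_loss b
  - lambda2 * (t * (1 - t) * sql2norm (a - b)).
Proof.
move=> t01; rewrite /freq_loss sql2norm_convex.
have -> : mean f (fun x => dot ((1 - t) *: a + t *: b) (phi x)) =
    (1 - t) * mean f (fun x => dot a (phi x))
    + t * mean f (fun x => dot b (phi x)).
  rewrite /mean !mulr_sumr -big_split/=; apply: eq_bigr => x _.
  by rewrite dotDl !dotZl; ring.
have lnle := lse_convex (fun x => dot a (phi x)) (fun x => dot b (phi x))
  v_ge0 v_gt0 t01.
under eq_bigr do rewrite dotDl !dotZl.
case/andP: t01 => t0 t1.
have l1le : l1norm ((1 - t) *: a + t *: b) <=
    (1 - t) * l1norm a + t * l1norm b.
  apply: le_trans (l1normD _ _) _; rewrite !l1normZ.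
  by rewrite !ger0_norm// subr_ge0.
have := ler_wpM2l lambda1_ge0 l1le.
move: lnle; lra.
Qed.

(** The midpoint of two distinct minimizers would have a strictly smaller loss. *)
Lemma argmin_freq_loss_unique (a b : 'cV[R]_p) : 0 < lambda2 ->
  is_argmin freq_loss a -> is_argmin freq_loss b -> a = b.
Proof.
move=> l2 amin bmin.
have half01 : 0 <= (1 / 2 : R) <= 1 by apply/andP; split; lra.
have := freq_loss_convex a b half01.
set c := _ + _ => hc; have := amin c; have := amin b; have := bmin a => h1 h2 h3.
apply/eqP; rewrite -subr_eq0 -sql2norm_eq0 eq_le sql2norm_ge0 andbT.
by rewrite -(pmulr_rle0 _ l2); lra.
Qed.

End PenalizedLoss.

(** * Deterministic bound on the estimation error *)

Section EstimationError.
Context {R : realType} {X : finType} {p : nat}.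
Variables (phi : X -> 'cV[R]_p) (theta : 'cV[R]_p) (K : R).
Hypothesis phi_le : forall x, `|phi x| <= K.

Local Notation pi := (model_pmf phi theta).

Lemma dot_phi_le (u : 'cV[R]_p) x : `|dot u (phi x)| <= K * l1norm u.
Proof.
apply: le_trans (norm_dot_le _ _) _.
by rewrite mulrC ler_wpM2r ?l1norm_ge0.
Qed.

(** The linear term [mean pi z] of the log-partition lower bound cancels against the data term up to
    the deviation of [f], and the penalties drop by at most a multiple of [l1norm u]; what is left
    must dominate the variance. *)
Lemma freq_loss_excess (f v : X -> R) (lambda1 lambda2 eps delta : R)
    (u : 'cV[R]_p) (x0 : X) :
  0 <= lambda1 -> 0 <= lambda2 ->
  (forall x, `|f x - pi x| <= eps) -> (forall x, `|v x - 1| <= delta) ->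
  delta <= 1 / 2 -> K * l1norm u <= 1 / 2 ->
  freq_loss phi f v lambda1 lambda2 (theta + u) <=
  freq_loss phi f v lambda1 lambda2 theta ->
  var pi (fun x => dot u (phi x)) <=
  24 * l1norm u * (K * (#|X|%:R * eps + 4 * delta)
                   + lambda1 + 2 * `|theta| * lambda2).
Proof.
move=> l1 l2 feps vdelta d2 Ku le_loss.
set z := fun x => dot u (phi x).
have pi_distr := model_pmf_distribution phi theta x0.
have zle x : `|z x| <= K * l1norm u := dot_phi_le u x.
have excess := reweighted_log_mgf_ge pi_distr vdelta d2 zle Ku.
have C0 := norm_const_gt0 phi theta x0.
have v0 x : 0 <= v x.
  by have := vdelta x; rewrite ler_norml => /andP[? _]; lra.
have v1 : 0 < \sum_x v x.
  rewrite (bigD1 x0)//= ltr_pwDl ?sumr_ge0//.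
  by have := vdelta x0; rewrite ler_norml => /andP[? _]; lra.
(* The weights exp(theta . phi) are [norm_const] times [pi], and the constant cancels in the
   difference. *)
have lnE : ln (\sum_x v x * expR (dot (theta + u) (phi x)))
    - ln (\sum_x v x * expR (dot theta (phi x))) =
    ln (\sum_x v x * pi x * expR (z x)) - ln (\sum_x v x * pi x).
  have -> : \sum_x v x * expR (dot (theta + u) (phi x)) =
      norm_const phi theta * \sum_x v x * pi x * expR (z x).
    rewrite mulr_sumr; apply: eq_bigr => x _.
    rewrite dotDl expRD /model_pmf -/(z x).
    by field; rewrite gt_eqF.
  have -> : \sum_x v x * expR (dot theta (phi x)) =
      norm_const phi theta * \sum_x v x * pi x.
    rewrite mulr_sumr; apply: eq_bigr => x _.
    by rewrite mulrCA [X in _ = _ * X]mulrC divfK ?gt_eqF.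
  have pi0 x : 0 < pi x by rewrite divr_gt0 ?expR_gt0.
  have vpi0 x : 0 <= v x * pi x by rewrite mulr_ge0// ltW.
  have vpi1 : 0 < \sum_x v x * pi x.
    rewrite (bigD1 x0)//= ltr_pwDl ?sumr_ge0// mulr_gt0//.
    by have := vdelta x0; rewrite ler_norml => /andP[? _]; lra.
  by rewrite !lnM ?posrE ?sum_expR_gt0//; ring.
have mean_diff : mean f z - mean pi z <= #|X|%:R * eps * (K * l1norm u).
  rewrite /mean -sumrB.
  apply: le_trans (_ : \sum_(x : X) eps * (K * l1norm u) <= _); last first.
    by rewrite sumr_const -mulrA mulr_natl.
  apply: ler_sum => x _; rewrite -mulrBl; apply: le_trans (ler_norm _) _.
  by rewrite normrM ler_pM.
have meanD : mean f (fun x => dot (theta + u) (phi x)) =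
    mean f (fun x => dot theta (phi x)) + mean f z.
  rewrite /mean -big_split/=; apply: eq_bigr => x _.
  by rewrite dotDl mulrDr.
have l1le : l1norm theta - l1norm (theta + u) <= l1norm u.
  have := l1normD (theta + u) ((- 1) *: u).
  by rewrite l1normZ normrN1 mul1r scaleN1r addrK -lerBlDl.
have sq := sql2norm_decrease_le u theta.
have pl1 := ler_wpM2l l1 l1le; have pl2 := ler_wpM2l l2 sq.
move: le_loss; rewrite /freq_loss meanD.
move: (ln _) (ln _) lnE excess => a1 a2 lnE excess.
lra.
Qed.

End EstimationError.

(** For the full set [T] the cone is the whole space for every zeta > 1, and the denominator is the
    full l1 norm; zeta = 2 is an arbitrary choice. *)
Lemma compat_quadratic {R : realType} {p : nat} (s : nat) (Cmin : R)
    (Sigma : 'M[R]_p) (u : 'cV[R]_p) :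
  (Cmin%:E <= ereal_inf [set ereal_inf
     [set compat_factor s zeta T Sigma | zeta in [set zeta : R | (1 < zeta)%R]]
     | T in [set: {set 'I_p}]])%E ->
  Cmin * l1norm u ^+ 2 <= s%:R * dot u (Sigma *m u).
Proof.
move=> /ereal_infP compat.
have [->|u_neq0] := eqVneq u 0.
  have /eqP -> : l1norm (0 : 'cV[R]_p) == 0 by rewrite l1norm_eq0.
  by rewrite mulmx0 dotE big1 ?expr0n ?mulr0// => j _; rewrite mxE mul0r.
have l1T : l1norm_on [set: 'I_p]%SET u = l1norm u.
  by apply: eq_bigl => j; rewrite inE.
have l1C : l1norm_on (~: [set: 'I_p])%SET u = 0.
  by rewrite /l1norm_on big_pred0// => j; rewrite !inE.
have l1_gt0 : 0 < l1norm u by rewrite lt_neqAle eq_sym l1norm_eq0 u_neq0 l1norm_ge0.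
rewrite -ler_pdivlMr ?exprn_gt0// -lee_fin.
apply: le_trans (compat _ _) _; first by exists [set: 'I_p]%SET.
apply: ge_ereal_inf; exists (compat_factor s 2 [set: 'I_p]%SET Sigma).
  by exists 2 => //=; rewrite ltr1n.
apply: ge_ereal_inf; exists (s%:R * dot u (Sigma *m u) / l1norm u ^+ 2)%:E => //.
exists u; last by rewrite l1T.
by split=> //; rewrite /cone/= l1T l1C mulr_ge0// l1norm_ge0.
Qed.

(** The excess-loss bound is local, valid for [K * l1norm u <= 1 / 2]. A minimizer outside this ball
    is pulled back to its boundary along the segment to [theta], where convexity keeps the loss at
    most that at [theta]. *)
Lemma estimation_error {R : realType} {X : finType} {p : nat}
    (phi : X -> 'cV[R]_p) (theta thetahat : 'cV[R]_p) (K Cmin B : R) (s : nat)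
    (f v : X -> R) (lambda1 lambda2 eps delta : R) (x0 : X) :
  0 < K -> (forall x, `|phi x| <= K) -> 0 < Cmin -> `|theta| <= B ->
  (forall u, Cmin * l1norm u ^+ 2 <= s%:R * dot u (model_cov phi theta *m u)) ->
  0 <= lambda1 -> 0 <= lambda2 ->
  (forall x, `|f x - model_pmf phi theta x| <= eps) ->
  (forall x, `|v x - 1| <= delta) -> delta <= 1 / 2 ->
  is_argmin (freq_loss phi f v lambda1 lambda2) thetahat ->
  let Gamma := K * (#|X|%:R * eps + 4 * delta) + lambda1 + 2 * B * lambda2 in
  K * (24 * s%:R * Gamma) < Cmin / 2 ->
  Cmin * l1norm (thetahat - theta) <= 24 * s%:R * Gamma.
Proof.
move=> K0 phiK C0 thB compat l1 l2 feps vdelta d2 argmin Gamma smallG.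
have eps0 : 0 <= eps := le_trans (normr_ge0 _) (feps x0).
have delta0 : 0 <= delta := le_trans (normr_ge0 _) (vdelta x0).
have B0 : 0 <= B := le_trans (normr_ge0 _) thB.
have G0 : 0 <= Gamma by rewrite /Gamma !addr_ge0// !mulr_ge0// ?addr_ge0// ?mulr_ge0// ltW.
have local u : K * l1norm u <= 1 / 2 ->
    freq_loss phi f v lambda1 lambda2 (theta + u) <=
    freq_loss phi f v lambda1 lambda2 theta ->
    Cmin * l1norm u <= 24 * s%:R * Gamma.
  move=> Ku le_loss.
  have := freq_loss_excess phiK x0 l1 l2 feps vdelta d2 Ku le_loss.
  rewrite -dot_model_cov => /(ler_wpM2l (ler0n R s)) var_le.
  have := le_trans (compat u) var_le => {var_le} quad_le.
  have [->|u0] := eqVneq (l1norm u) 0; first by rewrite mulr0 !mulr_ge0.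
  have {}u0 : 0 < l1norm u by rewrite lt_neqAle eq_sym u0 l1norm_ge0.
  have le_Gamma : K * (#|X|%:R * eps + 4 * delta) + lambda1
      + 2 * `|theta| * lambda2 <= Gamma.
    by rewrite lerD2l ler_wpM2r// ler_wpM2l.
  have c0 : 0 <= 24 * s%:R * l1norm u by rewrite !mulr_ge0// ltW.
  rewrite -(ler_pM2r u0); have := ler_wpM2l c0 le_Gamma; move: quad_le.
  by move: Gamma {smallG G0 le_Gamma c0} => Gamma; lra.
set D := l1norm (thetahat - theta).
have [KD|KD] := lerP (K * D) (1 / 2).
  by apply: local => //; rewrite addrC subrK; exact: argmin.
have D0 : 0 < D by rewrite -(pmulr_rgt0 _ K0); lra.
have KD0 : 0 < K * D by rewrite mulr_gt0.
pose t := 1 / 2 / (K * D).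
have t01 : 0 <= t <= 1.
  by rewrite divr_ge0//= ?ler_pdivrMr ?mul1r//; lra.
have v0 x : 0 <= v x.
  by have := vdelta x; rewrite ler_norml => /andP[? _]; lra.
have v1 : 0 < \sum_x v x.
  rewrite (bigD1 x0)//= ltr_pwDl ?sumr_ge0//.
  by have := vdelta x0; rewrite ler_norml => /andP[? _]; lra.
have tD : K * l1norm (t *: (thetahat - theta)) = 1 / 2.
  case/andP: t01 => t0 _; rewrite l1normZ ger0_norm// mulrCA /t -/D.
  by rewrite divfK// gt_eqF.
have : Cmin * l1norm (t *: (thetahat - theta)) <= 24 * s%:R * Gamma.
  apply: local; first by rewrite tD.
  have -> : theta + t *: (thetahat - theta) = (1 - t) *: theta + t *: thetahat.
    by rewrite scalerBr scalerBl scale1r addrA addrAC.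
  apply: le_trans (freq_loss_convex _ _ _ l1 v0 v1 _ _ t01) _.
  case/andP: t01 => t0 t1.
  have pen : 0 <= lambda2 * (t * (1 - t) * sql2norm (theta - thetahat)).
    by rewrite mulr_ge0// mulr_ge0 ?sql2norm_ge0// mulr_ge0// subr_ge0.
  have := ler_wpM2l t0 (argmin theta); lra.
(* On the boundary the local bound gives [Cmin / 2 <= K * (24 * s%:R * Gamma)], against [smallG]. *)
move=> /(ler_wpM2l (ltW K0)); rewrite mulrCA tD => ?; lra.
Qed.

(** * Reduction of the loss to empirical frequencies *)

Section EmpiricalFrequencies.
Context {R : realType} {X : finType}.

Definition freq (n : nat) (xs : nat -> X) (x : X) : R :=
  n%:R^-1 * \sum_(i < n) (xs i == x)%:R.

Lemma freq_ext n (xs xs' : nat -> X) :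
  (forall i, (i < n)%N -> xs i = xs' i) -> freq n xs = freq n xs'.
Proof.
move=> exs; apply/funext => x; congr (_ * _).
by apply: eq_bigr => i _; rewrite exs.
Qed.

Lemma average_freq n (xs : nat -> X) (g : X -> R) :
  n%:R^-1 * \sum_(i < n) g (xs i) = \sum_x freq n xs x * g x.
Proof.
under [RHS]eq_bigr do rewrite /freq -mulrA.
rewrite -mulr_sumr; congr (_ * _).
under [RHS]eq_bigr do rewrite mulr_suml.
rewrite exchange_big/=; apply: eq_bigr => i _.
rewrite (bigD1 (xs i))//= eqxx mul1r big1 ?addr0// => x.
by rewrite eq_sym => /negPf->; rewrite mul0r.
Qed.

Lemma penalized_lossE p (phi : X -> 'cV[R]_p) n m h lambda1 lambda2 xs ys :
  penalized_loss phi n m h lambda1 lambda2 xs ys =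
  freq_loss phi (freq n xs) (fun x => freq m ys x / h x) lambda1 lambda2.
Proof.
apply/funext => theta; rewrite /penalized_loss /freq_loss /neg_loglik_mc.
congr (- _ + ln _ + _ + _).
  exact: (average_freq n xs (fun x => dot theta (phi x))).
rewrite (average_freq m ys (fun x => expR (dot theta (phi x)) / h x)).
by apply: eq_bigr => x _; rewrite mulrA mulrAC.
Qed.

Lemma freq_ratio_ge0 m ys (h : X -> R) x : (forall x, 0 < h x) ->
  0 <= freq m ys x / h x.
Proof.
move=> h0; apply: divr_ge0; last exact: ltW.
by apply: mulr_ge0; rewrite ?invr_ge0 ?ler0n//; apply: sumr_ge0.
Qed.

Lemma sum_freq_ratio_gt0 m ys (h : X -> R) : (0 < m)%N -> (forall x, 0 < h x) ->
  0 < \sum_x freq m ys x / h x.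
Proof.
move=> m0 h0; rewrite -(average_freq m ys (fun x => (h x)^-1)).
rewrite mulr_gt0 ?invr_gt0 ?ltr0n// (bigD1 (Ordinal m0))//=.
by rewrite ltr_pwDl ?invr_gt0// sumr_ge0// => i _; rewrite invr_ge0 ltW.
Qed.

Lemma argmin_penalized_loss_unique p (phi : X -> 'cV[R]_p) n m h
    lambda1 lambda2 xs ys a b :
  0 < lambda1 -> 0 < lambda2 -> (0 < m)%N -> (forall x, 0 < h x) ->
  is_argmin (penalized_loss phi n m h lambda1 lambda2 xs ys) a ->
  is_argmin (penalized_loss phi n m h lambda1 lambda2 xs ys) b -> a = b.
Proof.
move=> l1 l2 m0 h0; rewrite penalized_lossE.
apply: argmin_freq_loss_unique => //; first exact: ltW.
- by move=> x; apply: freq_ratio_ge0.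
- exact: sum_freq_ratio_gt0.
Qed.

Lemma penalized_loss_ext p (phi : X -> 'cV[R]_p) n m h
    lambda1 lambda2 xs ys xs' ys' :
  (forall i, (i < n)%N -> xs i = xs' i) ->
  (forall i, (i < m)%N -> ys i = ys' i) ->
  penalized_loss phi n m h lambda1 lambda2 xs ys =
  penalized_loss phi n m h lambda1 lambda2 xs' ys'.
Proof.
move=> exs eys; rewrite !penalized_lossE.
by rewrite (freq_ext exs) (freq_ext eys).
Qed.

End EmpiricalFrequencies.

(** * Occupation frequencies of a Markov chain *)

Section PoissonEquation.
Context {R : realType} {X : finType}.
Variables (P : X -> X -> R) (h : X -> R).
Hypotheses (kerP : transition_kernel P) (irrP : chain_irreducible P).

Definition kernel_mean (Q : X -> X -> R) (psi : X -> R) (y : X) : R :=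
  \sum_z Q y z * psi z.

Lemma kernel_iter_distribution k y : distribution_on (kernel_iter P k y).
Proof.
elim: k y => [|k IH] y /=; split.
- by move=> x; rewrite ler0n.
- rewrite (bigD1 y)//= eqxx big1 ?addr0// => x.
  by rewrite eq_sym => /negPf->.
- move=> x; apply: sumr_ge0 => z _; rewrite mulr_ge0//.
    exact: (kerP y).1.
  exact: (IH z).1.
- rewrite exchange_big/= -[RHS](kerP y).2; apply: eq_bigr => z _.
  by rewrite -mulr_sumr (IH z).2 mulr1.
Qed.

Lemma stationary_iter : stationary P h ->
  forall k x, \sum_y h y * kernel_iter P k y x = h x.
Proof.
move=> [_ hh]; elim=> [|k IH] x /=.
  rewrite (bigD1 x)//= eqxx mulr1 big1 ?addr0// => y /negPf->.
  by rewrite mulr0.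
under eq_bigr do rewrite mulr_sumr.
rewrite exchange_big/= -[RHS]IH; apply: eq_bigr => z _.
by rewrite -[in RHS]hh mulr_suml; apply: eq_bigr => y _; rewrite mulrA.
Qed.

(** Some [y] has positive mass, and an iterate of the kernel leading from [y] to [x] leaves [h]
    invariant. *)
Lemma stationary_gt0 : stationary P h -> forall x, 0 < h x.
Proof.
move=> hst x; have [[h0 h1] _] := hst.
have [y hy] : exists y, 0 < h y.
  apply: contrapT => /forallNP no; have := @oner_neq0 R.
  rewrite -h1 big1 ?eqxx// => y _; apply/eqP.
  by rewrite eq_le h0 andbT leNgt; apply/negP.
have [k Pk] := irrP y x.
rewrite -(stationary_iter hst k x) (bigD1 y)//= ltr_pwDl ?mulr_gt0//.
by apply: sumr_ge0 => z _; rewrite mulr_ge0// (kernel_iter_distribution k z).1.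
Qed.

(** Maximum principle: the nonnegative gaps below a maximal value [psi x0] average to zero under
    every iterate from [x0], so they vanish wherever an iterate charges. *)
Lemma harmonic_const (psi : X -> R) :
  (forall y, kernel_mean P psi y = psi y) -> forall x y, psi x = psi y.
Proof.
move=> harm.
have harmk k y : kernel_mean (kernel_iter P k) psi y = psi y.
  elim: k y => [|k IH] y; rewrite /kernel_mean /=.
    rewrite (bigD1 y)//= eqxx mul1r big1 ?addr0// => x.
    by rewrite eq_sym => /negPf->; rewrite mul0r.
  under eq_bigr do rewrite mulr_suml.
  rewrite exchange_big/= -[RHS]harm; apply: eq_bigr => z _.
  by rewrite -[in RHS](IH z) mulr_sumr; apply: eq_bigr => x _; rewrite mulrA.
move=> x y; have [x0 _ x0max] := arg_maxP psi (erefl (xpredT x)).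
suff max_eq z : psi z = psi x0 by rewrite !max_eq.
have [k Pk] := irrP x0 z.
have [Pk0 Pk1] := kernel_iter_distribution k x0.
have : \sum_z' kernel_iter P k x0 z' * (psi x0 - psi z') = 0.
  under eq_bigr do rewrite mulrBr.
  by rewrite sumrB -mulr_suml Pk1 mul1r -[X in X - _](harmk k) subrr.
move=> /eqP; rewrite psumr_eq0; last first.
  by move=> z' _; rewrite mulr_ge0// subr_ge0; exact: x0max.
move=> /allP/(_ z (mem_index_enum z)) /=.
by rewrite mulf_eq0 gt_eqF//= subr_eq0 => /eqP.
Qed.

(* [I - P + 1 h^T] is invertible and maps the solution to [g]. *)
Lemma poisson_equation (g : X -> R) : stationary P h ->
  \sum_x h x * g x = 0 ->
  exists psi : X -> R, forall y, psi y - kernel_mean P psi y = g y.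
Proof.
move=> [[h0 h1] hst] hg.
(* The transpose of I - P + 1 h^T, because functions are encoded as row vectors acting from the
   left. *)
pose Q : 'M[R]_#|X| := \matrix_(i, j)
  ((i == j)%:R - P (enum_val j) (enum_val i) + h (enum_val i)).
have QE (u : 'rV[R]_#|X|) y (psi := fun x => u 0 (enum_rank x)) :
    (u *m Q) 0 (enum_rank y) =
    psi y - kernel_mean P psi y + \sum_z h z * psi z.
  rewrite mxE (reindex enum_rank)/=; last exact/onW_bij/enum_rank_bij.
  rewrite /kernel_mean /psi.
  have -> : u 0 (enum_rank y) = \sum_z u 0 (enum_rank z) * (z == y)%:R.
    rewrite (bigD1 y)//= eqxx mulr1 big1 ?addr0// => z /negPf->.
    by rewrite mulr0.
  rewrite -sumrB -big_split/=; apply: eq_bigr => z _.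
  by rewrite mxE !enum_rankK (inj_eq enum_rank_inj); ring.
(* Pairing with the invariant [h] kills [psi - P psi]. *)
have hQ (psi : X -> R) c : (forall y, psi y - kernel_mean P psi y +
    \sum_z h z * psi z = c y) -> \sum_z h z * psi z = \sum_z h z * c z.
  move=> eqc; under [RHS]eq_bigr do rewrite -eqc mulrDr mulrBr.
  rewrite big_split/= sumrB -mulr_suml h1 mul1r.
  suff -> : \sum_y h y * kernel_mean P psi y = \sum_y h y * psi y.
    by rewrite subrr add0r.
  under eq_bigr do rewrite mulr_sumr.
  rewrite exchange_big/=; apply: eq_bigr => z _.
  by rewrite -[in RHS]hst mulr_suml; apply: eq_bigr => y _; rewrite mulrA.
(* A vector sent to 0 has [h]-mean 0, so it is harmonic, hence constant, hence 0. *)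
have Qunit : Q \in unitmx.
  rewrite -row_free_unit; apply: inj_row_free => u uQ.
  pose psi x := u 0 (enum_rank x).
  have psiE y : psi y - kernel_mean P psi y + \sum_z h z * psi z = 0.
    by rewrite -QE uQ mxE.
  have hpsi : \sum_z h z * psi z = 0.
    by rewrite (hQ _ _ psiE) big1// => z _; rewrite mulr0.
  have cst := harmonic_const (psi := psi).
  have {}cst x y : psi x = psi y.
    apply: cst => z; apply/eqP; rewrite eq_sym -subr_eq0.
    by have := psiE z; rewrite hpsi addr0 => ->.
  apply/matrixP => i j; rewrite (ord1 i) mxE -[j]enum_valK -/(psi _).
  rewrite -[RHS]hpsi; under eq_bigr do rewrite (cst _ (enum_val j)).
  by rewrite -mulr_suml h1 mul1r.
pose u := (\row_j g (enum_val j)) *m invmx Q.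
exists (fun x => u 0 (enum_rank x)) => y.
have uE z := QE u z.
have guE z : (u *m Q) 0 (enum_rank z) = g z by rewrite mulmxKV// mxE enum_rankK.
(* As [g] has [h]-mean 0, so has the solution, and the rank-one term drops out. *)
have := hQ (fun x => u 0 (enum_rank x)) g; rewrite hg => hu.
by rewrite -[RHS]guE uE hu ?addr0// => z; rewrite -uE guE.
Qed.

Lemma poisson_indicators : stationary P h ->
  exists (psi : X -> X -> R) (C : R), 0 < C /\ forall x y,
    `|psi x y| <= C /\ psi x y - kernel_mean P (psi x) y = (y == x)%:R - h x.
Proof.
move=> hst; have [[h0 h1] _] := hst.
have /choice[psi psiE] : forall x, exists psi : X -> R,
    forall y, psi y - kernel_mean P psi y = (y == x)%:R - h x.
  move=> x; apply: poisson_equation => //.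
  under eq_bigr do rewrite mulrBr.
  rewrite sumrB -mulr_suml h1 mul1r (bigD1 x)//= eqxx mulr1 big1 ?addr0 ?subrr//.
  by move=> y /negPf->; rewrite mulr0.
(* On a finite space the sum of all values bounds each one; the 1 makes the bound positive. *)
exists psi, (1 + \sum_x \sum_y `|psi x y|); split.
  by rewrite ltr_pwDl// sumr_ge0// => x _; rewrite sumr_ge0.
move=> x y; split => //.
apply: ler_wpDl => //; rewrite (bigD1 x)//= (bigD1 y)//= -addrA lerDl addr_ge0//.
  exact: sumr_ge0.
by apply: sumr_ge0 => x' _; exact: sumr_ge0.
Qed.

End PoissonEquation.

(** * Finite-valued random variables and expectations over paths *)

Section DiscreteVariables.
Context {R : realType} {disp : measure_display} {Omega : measurableType disp}.
Variable Pr : probability Omega R.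

Lemma discrete_rv_measurable (T : finType) (W : Omega -> T) (A : set T) :
  discrete_rv W -> measurable [set w | A (W w)].
Proof.
move=> dW; have -> : [set w | A (W w)] = \bigcup_(t in A) [set w | W w = t].
  by apply/seteqP; split => [w Aw|w [t At /= ->//]]; exists (W w).
by apply: fin_bigcup_measurable => // t _; exact: dW.
Qed.

(** Such an event is a finite union of level sets of [W]; events about the estimator are shown
    measurable in this way. *)
Lemma measurable_determined (T : finType) (W : Omega -> T) (E : set Omega) :
  discrete_rv W -> (forall w w', W w = W w' -> E w -> E w') -> measurable E.
Proof.
move=> dW detE.
rewrite (_ : E = [set w | [set t | exists2 w', W w' = t & E w'] (W w)]).
  exact: discrete_rv_measurable.
by apply/seteqP; split => [w Ew|w [w' ww' Ew']]; [exists w|exact: detE ww' Ew'].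
Qed.

Lemma discrete_rv_probability (T : finType) (W : Omega -> T) (A : pred T) :
  discrete_rv W ->
  Pr [set w | A (W w)] = (\sum_(t | A t) fine (Pr [set w | W w = t]))%:E.
Proof.
move=> dW.
have -> : [set w | A (W w)] = \bigcup_(t in [set` A]) [set w | W w = t].
  by apply/seteqP; split => [w Aw|w [t At /= ->//]]; exists (W w).
rewrite measure_fin_bigcup//; last by move=> s t _ _ [w [/= <- <-]].
rewrite -(@bigfs _ _ _ _ (index_enum T) A) ?index_enum_uniq//; last first.
  by move=> t _; rewrite mem_index_enum.
rewrite -sumEFin; apply: eq_bigr => t _.
by rewrite fineK// fin_num_measure//; exact: dW.
Qed.

Lemma discrete_rv_pair (T U : finType) (V : Omega -> T) (W : Omega -> U) :
  discrete_rv V -> discrete_rv W -> discrete_rv (fun w => (V w, W w)).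
Proof.
move=> dV dW [t u].
have -> : [set w | (V w, W w) = (t, u)] = [set w | V w = t] `&` [set w | W w = u].
  by apply/seteqP; split => [w [/= <- <-]|w [/= <- <-]].
exact: measurableI.
Qed.

Variable X : finType.

Definition sample (Z : nat -> Omega -> X) (k : nat) (w : Omega) : k.-tuple X :=
  [tuple Z i w | i < k].

Lemma sample_eq (x0 : X) Z k (t : k.-tuple X) :
  [set w | sample Z k w = t] =
  [set w | forall i, (i < k)%N -> Z i w = nth x0 t i].
Proof.
apply/seteqP; split => w /=.
  by move=> <- i ik; rewrite -(tnth_nth _ _ (Ordinal ik)) tnth_mktuple.
move=> Zt; apply: eq_from_tnth => i; rewrite tnth_mktuple (tnth_nth x0).
exact: Zt.
Qed.

Lemma sample_coord (Z : nat -> Omega -> X) k w w' : sample Z k w = sample Z k w' ->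
  forall i, (i < k)%N -> Z i w = Z i w'.
Proof.
move=> eqs i ik; have := congr1 (fun t => tnth t (Ordinal ik)) eqs.
by rewrite !tnth_mktuple.
Qed.

Lemma sampleS Z k w : sample Z k.+1 w = rcons_tuple (sample Z k w) (Z k w).
Proof.
apply: eq_from_tnth => i; rewrite tnth_mktuple (tnth_nth (Z k w)).
rewrite [tval _](_ : _ = rcons (sample Z k w) (Z k w))// nth_rcons size_tuple.
case: ltngtP => [ik|ki|->//].
  by rewrite -(tnth_nth _ _ (Ordinal ik)) tnth_mktuple.
by have := ltn_ord i; rewrite ltnS leqNgt ki.
Qed.

Lemma discrete_rv_sample Z k : (forall i, (i < k)%N -> discrete_rv (Z i)) ->
  discrete_rv (sample Z k).
Proof.
elim: k => [|k IH] dZ t.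
  rewrite (_ : [set w | _] = setT)//; apply/seteqP; split => // w _ /=.
  by rewrite [LHS]tuple0 [RHS]tuple0.
rewrite (_ : [set w | _] = [set w | rcons_tuple (sample Z k w) (Z k w) = t]).
  apply: (@discrete_rv_measurable _ (fun w => (sample Z k w, Z k w))
    [set u | rcons_tuple u.1 u.2 = t]).
  by apply: discrete_rv_pair; [apply: IH => i /ltnW/dZ|exact: dZ].
by apply/seteqP; split => w /=; rewrite sampleS.
Qed.

Lemma measurable_sample_determined (Z : nat -> Omega -> X) k (E : set Omega) :
  (forall i, (i < k)%N -> discrete_rv (Z i)) ->
  (forall w w', (forall i, (i < k)%N -> Z i w = Z i w') -> E w -> E w') ->
  measurable E.
Proof.
move=> dZ detE; apply: (measurable_determined (discrete_rv_sample dZ)).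
by move=> w w' /sample_coord; exact: detE.
Qed.

(** The expectation of [F] at the first [k] entries, as a finite sum over paths. [F] acts on [seq]
    so that one functional serves all lengths. *)
Definition path_mean (Z : nat -> Omega -> X) (k : nat) (F : seq X -> R) : R :=
  \sum_(t : k.-tuple X) fine (Pr [set w | sample Z k w = t]) * F t.

Lemma path_mean1 Z k : (forall i, (i < k)%N -> discrete_rv (Z i)) ->
  path_mean Z k (fun=> 1) = 1.
Proof.
move=> dZ; rewrite /path_mean; under eq_bigr do rewrite mulr1.
apply: EFin_inj; have := discrete_rv_probability predT (discrete_rv_sample dZ).
move=> /= <-; rewrite -[RHS](probability_setT Pr); congr (Pr _).
by apply/seteqP; split.
Qed.

Lemma markov_inequality Z k (F : seq X -> R) (c : R) :
  (forall i, (i < k)%N -> discrete_rv (Z i)) -> (forall s, 0 <= F s) -> 0 < c ->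
  (Pr [set w | (c < F (sample Z k w))%R] <= (path_mean Z k F / c)%:E)%E.
Proof.
move=> dZ F0 c0.
have := discrete_rv_probability (fun t : k.-tuple X => c < F t) (discrete_rv_sample dZ).
move=> /= ->; rewrite lee_fin ler_pdivlMr// mulr_suml /path_mean.
rewrite [leRHS](bigID (fun t : k.-tuple X => c < F t))/=.
apply: ler_wpDr.
  by apply: sumr_ge0 => t _; rewrite mulr_ge0// fine_ge0// measure_ge0.
by apply: ler_sum => t ct; rewrite ler_wpM2l ?fine_ge0 ?measure_ge0// ltW.
Qed.

Lemma sum_rcons_tuple n (F : n.+1.-tuple X -> R) :
  \sum_t F t = \sum_(t : n.-tuple X) \sum_x F (rcons_tuple t x).
Proof.
rewrite pair_bigA/=.
pose e (u : n.-tuple X * X) := rcons_tuple u.1 u.2.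
rewrite (reindex e)//; apply: onW_bij; apply: inj_card_bij.
  move=> [t x] [t' x'] /(congr1 val)/= /rcons_inj[tt' ->].
  by congr pair; exact: val_inj.
by rewrite card_prod !card_tuple expnSr.
Qed.

End DiscreteVariables.

(** * Second moments of occupation counts *)

Section MarkovMoments.
Context {R : realType} {X : finType} {disp : measure_display}
  {Omega : measurableType disp}.
Variables (Pr : probability Omega R) (m : nat) (q : X -> R) (P : X -> X -> R)
  (Z : nat -> Omega -> X).
Hypotheses (kerP : transition_kernel P) (chainZ : markov_chain Pr m q P Z).

Lemma discrete_rv_chain k i : (k <= m)%N -> (i < k)%N -> discrete_rv (Z i).
Proof. by move=> km ik; case: chainZ => dZ _ _; apply/dZ/(leq_trans ik). Qed.

(** Conditioning on all but the last of k + 2 entries. The remaining path is nonempty, so [last]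
    never returns its default [x0]. *)
Lemma path_mean_step k (F : seq X -> R) (x0 : X) : (k.+1 < m)%N ->
  path_mean Pr Z k.+2 F = path_mean Pr Z k.+1
    (fun s => kernel_mean P (fun x => F (rcons s x)) (last x0 s)).
Proof.
move=> km; rewrite /path_mean sum_rcons_tuple; apply: eq_bigr => t _.
rewrite /kernel_mean mulr_sumr; apply: eq_bigr => x _; rewrite mulrA.
congr (_ * _); case: chainZ => _ _ /(_ k (nth x0 (rcons t x)) km) step.
have tk1 : nth x0 (rcons t x) k.+1 = x by rewrite nth_rcons size_tuple ltnn eqxx.
have tk : nth x0 (rcons t x) k = last x0 t.
  by rewrite nth_rcons size_tuple ltnSn -nth_last size_tuple.
rewrite !(sample_eq x0)/=; rewrite step tk tk1.
have -> : [set w | forall i, (i <= k)%N -> Z i w = nth x0 (rcons t x) i] =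
    [set w | forall i, (i < k.+1)%N -> Z i w = nth x0 t i].
  apply/seteqP; split => w Zw i ik; rewrite (Zw i ik) nth_rcons size_tuple;
    by move: ik; rewrite !ltnS => ->.
have fin : Pr [set w | forall i, (i < k.+1)%N -> Z i w = nth x0 t i]
    \is a fin_num.
  rewrite -sample_eq; apply: fin_num_measure.
  by apply: (discrete_rv_sample (fun i => @discrete_rv_chain k.+1 i (ltnW km))).
by rewrite fineM.
Qed.

(* Gordin's decomposition: [S_k + P psi(Z_(k-1))] is a martingale with bounded
   increments [psi(Z_k) - P psi(Z_(k-1))]. *)
Lemma poisson_second_moment (psi : X -> R) (C : R) k :
  (forall x, `|psi x| <= C) -> (0 < k <= m)%N ->
  path_mean Pr Z k (fun s => (\sum_(y <- s) (psi y - kernel_mean P psi y)) ^+ 2)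
  <= 10 * C ^+ 2 * k%:R.
Proof.
move=> psiC; case: k => // k /= km.
have [x0 _|X0] := pickP (@predT X); last first.
  rewrite /path_mean big1 => [|t _]; first by rewrite mulr_ge0// mulr_ge0// sqr_ge0.
  by have := X0 (thead t).
have C0 : 0 <= C := le_trans (normr_ge0 _) (psiC x0).
have PpsiC y : `|kernel_mean P psi y| <= C.
  apply: le_trans (ler_norm_sum _ _ _) _.
  rewrite -[leRHS]mul1r -(kerP y).2 mulr_suml; apply: ler_sum => z _.
  by rewrite normrM ger0_norm ?(kerP y).1// ler_wpM2l// (kerP y).1.
pose S s := \sum_(y <- s) (psi y - kernel_mean P psi y).
pose M s := S s + kernel_mean P psi (last x0 s).
have Mrcons s x : M (rcons s x) = S s + psi x.
  by rewrite /M /S big_rcons last_rcons/= -addrA subrK.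
have E1 j : (j < m)%N -> path_mean Pr Z j.+1 (fun=> 1) = 1.
  by move=> jm; apply: path_mean1 => i; exact: discrete_rv_chain.
(* The initial value is psi(Z_0), with square at most C^2. Later increments are centred given the
   past, so cross terms vanish, and bounded by 2 C, so each step adds at most 4 C^2. *)
have EM j : (j < m)%N ->
    path_mean Pr Z j.+1 (fun s => M s ^+ 2) <= 4 * C ^+ 2 * j.+1%:R.
  elim: j => [|j IH] jm.
    apply: le_trans (_ : path_mean Pr Z 1 (fun=> 1) * C ^+ 2 <= _).
      rewrite mulr_suml; apply: ler_sum => t _; rewrite -mulrA.
      rewrite ler_wpM2l ?fine_ge0 ?measure_ge0// mul1r.
      have tE : tval t = rcons [::] (thead t).
        by case/tupleP: t => x t'; rewrite theadE (tuple0 t').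
      rewrite tE Mrcons /S big_nil add0r -real_normK ?num_real//.
      by rewrite ler_sqr ?nnegrE.
    by rewrite E1// mul1r mulr1 ler_peMl ?sqr_ge0// ler1n.
  rewrite (path_mean_step _ x0)//.
  apply: le_trans (_ : path_mean Pr Z j.+1 (fun s => M s ^+ 2)
      + path_mean Pr Z j.+1 (fun=> 1) * (4 * C ^+ 2) <= _); last first.
    rewrite E1 ?(ltnW jm)// mul1r -[j.+2%:R]natr1 mulrDr mulr1 lerD2r.
    exact/IH/ltnW.
  rewrite mulr_suml -big_split/=; apply: ler_sum => t _.
  rewrite mulr1 -mulrDr ler_wpM2l ?fine_ge0 ?measure_ge0//.
  set y := last x0 t; have [Py0 Py1] := kerP y.
  pose D x := psi x - kernel_mean P psi y.
  have D0 : \sum_x P y x * D x = 0.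
    under eq_bigr do rewrite mulrBr.
    by rewrite sumrB -mulr_suml Py1 mul1r subrr.
  rewrite /kernel_mean (eq_bigr (fun x => M t ^+ 2 * P y x
      + 2 * M t * (P y x * D x) + P y x * D x ^+ 2)); last first.
    by move=> x _; rewrite Mrcons /M -/y /D; ring.
  rewrite !big_split/= -!mulr_sumr D0 Py1 mulr0 mulr1 addr0 lerD2l.
  apply: le_trans (_ : \sum_x P y x * (4 * C ^+ 2) <= _); last first.
    by rewrite -mulr_suml Py1 mul1r.
  apply: ler_sum => x _.
  rewrite ler_wpM2l//; apply: le_trans (_ : (2 * C) ^+ 2 <= _); last first.
    by rewrite exprMn -natrX.
  rewrite -real_normK ?num_real// ler_sqr ?nnegrE ?mulr_ge0//.
  apply: le_trans (ler_normB _ _) _.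
  by have := psiC x; have := PpsiC y; lra.
(* [S] is [M] minus a term bounded by [C], and (a - b)^2 <= 2 a^2 + 2 b^2; with [EM] the total is 8
   C^2 (k + 1) + 2 C^2. *)
apply: le_trans (_ : 2 * path_mean Pr Z k.+1 (fun s => M s ^+ 2)
    + 2 * C ^+ 2 * path_mean Pr Z k.+1 (fun=> 1) <= _).
  rewrite !mulr_sumr -big_split/=; apply: ler_sum => t _; rewrite mulr1.
  set l := fine _; have l0 : 0 <= l by rewrite fine_ge0.
  have SE : S t = M t - kernel_mean P psi (last x0 t) by rewrite /M addrK.
  rewrite -/(S t) SE; have := PpsiC (last x0 t).
  move: (M t) (kernel_mean P psi _) => a b bC.
  have bC2 : b ^+ 2 <= C ^+ 2.
    by rewrite -real_normK ?num_real// ler_sqr ?nnegrE.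
  have le_sq : (a - b) ^+ 2 <= 2 * a ^+ 2 + 2 * C ^+ 2.
    by have := sqr_ge0 (a + b); lra.
  by have := ler_wpM2l l0 le_sq; lra.
rewrite E1//; have := EM k km.
have : 1 <= k.+1%:R :> R by rewrite ler1n.
have := sqr_ge0 C; move: (C ^+ 2) (path_mean _ _ _ _) (k.+1%:R) => c e r; nra.
Qed.

(** Chebyshev's inequality: by Poisson's equation, [m] times the deviation at [x] is the sum
    controlled by [poisson_second_moment]. *)
Lemma freq_deviation (h : X -> R) (psi : X -> X -> R) (C c : R) :
  (forall x y, `|psi x y| <= C) ->
  (forall x y, psi x y - kernel_mean P (psi x) y = (y == x)%:R - h x) ->
  (0 < m)%N -> 0 < c ->
  (Pr [set w | (c < \sum_x (freq m (Z^~ w) x - h x) ^+ 2)%R]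
   <= (#|X|%:R * (10 * C ^+ 2) / (m%:R * c))%:E)%E.
Proof.
move=> psiC psiE m0 c0.
have m0R : 0 < m%:R :> R by rewrite ltr0n.
pose F (s : seq X) := \sum_x
  (\sum_(y <- s) (psi x y - kernel_mean P (psi x) y)) ^+ 2.
have FE w : F (sample Z m w) =
    m%:R ^+ 2 * \sum_x (freq m (Z^~ w) x - h x) ^+ 2.
  rewrite mulr_sumr; apply: eq_bigr => x _; rewrite -exprMn; congr (_ ^+ 2).
  under eq_bigr do rewrite psiE.
  rewrite big_tuple sumrB mulrBr /freq mulVKf ?gt_eqF//; congr (_ - _).
    by apply: eq_bigr => i _; rewrite tnth_mktuple.
  by rewrite sumr_const card_ord mulr_natl.
have -> : [set w | c < \sum_x (freq m (Z^~ w) x - h x) ^+ 2] =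
    [set w | m%:R ^+ 2 * c < F (sample Z m w)].
  by apply/seteqP; split => w /=; rewrite FE ltr_pM2l ?exprn_gt0.
have mc0 : 0 < m%:R ^+ 2 * c by rewrite mulr_gt0 ?exprn_gt0.
apply: le_trans (markov_inequality Pr _ _ mc0) _.
- by move=> i; exact: discrete_rv_chain.
- by move=> s; apply: sumr_ge0 => x _; exact: sqr_ge0.
rewrite lee_fin ler_pdivrMr//.
have -> : #|X|%:R * (10 * C ^+ 2) / (m%:R * c) * (m%:R ^+ 2 * c) =
    #|X|%:R * (10 * C ^+ 2 * m%:R).
  by field; rewrite !gt_eqF.
rewrite /path_mean; under eq_bigr do rewrite mulr_sumr.
rewrite exchange_big/=.
apply: le_trans (_ : \sum_(x : X) 10 * C ^+ 2 * m%:R <= _).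
  apply: ler_sum => x _; apply: poisson_second_moment => //.
  by rewrite m0 leqnn.
by rewrite sumr_const [leRHS]mulr_natl.
Qed.

End MarkovMoments.

(** * Independent samples as a chain with constant kernel *)

Section IidSample.
Context {R : realType} {X : finType} {disp : measure_display}
  {Omega : measurableType disp}.
Variables (Pr : probability Omega R) (n : nat) (f : X -> R)
  (xs : nat -> Omega -> X).

Lemma iid_sample_markov_chain : iid_sample Pr n f xs ->
  markov_chain Pr n f (fun=> f) xs.
Proof.
move=> [dxs fxs indep]; split=> // [n0|k a kn]; first exact: fxs.
have cyl j : (j < n)%N -> Pr [set w | forall i, (i <= j)%N -> xs i w = a i] =
    (\prod_(i < n | (i <= j)%N) (f (a i))%:E)%E.
  move=> jn.
  (* Independence is stated for all [n] coordinates at once, so those beyond [j] are left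
     unconstrained and contribute factors 1. *)
  pose A (i : 'I_n) : {set X} := if (i <= j)%N then [set a i]%SET else [set: X]%SET.
  have -> : [set w | forall i, (i <= j)%N -> xs i w = a i] =
      [set w | forall i : 'I_n, xs i w \in A i].
    apply/seteqP; split => w Aw i.
      by rewrite /A; case: ifP => ij; rewrite ?inE// (Aw i ij).
    move=> ij; have := Aw (Ordinal (leq_ltn_trans ij jn)).
    by rewrite /A/= ij inE => /eqP.
  rewrite indep [RHS]big_mkcond/=; apply: eq_bigr => i _; rewrite /A.
  case: ifP => ij; last first.
    rewrite (_ : [set w | _] = setT) ?probability_setT//.
    by apply/seteqP; split => // w _ /=; rewrite inE.
  rewrite -(fxs i (ltn_ord i)); congr (Pr _).
  by apply/seteqP; split => w /=; rewrite inE => /eqP.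
rewrite !cyl//; last exact: ltnW.
rewrite (bigD1 (Ordinal kn))//= muleC; congr (_ * _)%E.
apply: eq_bigl => i; rewrite -val_eqE/= leq_eqVlt ltnS.
by case: eqP => [->|_]; rewrite ?ltnn ?andbT// leqNgt ltnSn.
Qed.

Lemma iid_freq_deviation (c : R) : distribution_on f ->
  iid_sample Pr n f xs -> (0 < n)%N -> 0 < c ->
  (Pr [set w | (c < \sum_x (freq n (xs^~ w) x - f x) ^+ 2)%R]
   <= (#|X|%:R * 10 / (n%:R * c))%:E)%E.
Proof.
move=> df ixs n0 c0; have [f0 f1] := df.
have f_le1 x : f x <= 1.
  by rewrite -f1 (bigD1 x)//= lerDl sumr_ge0.
(* For the constant kernel [f], the centred indicator has kernel mean 0 and solves its own Poisson
   equation; it is bounded by 1. *)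
have := @freq_deviation _ _ _ _ Pr n f (fun=> f) xs (fun=> df)
  (iid_sample_markov_chain ixs) f (fun x y => (y == x)%:R - f x) 1 c.
rewrite expr1n mulr1; apply => // x y.
  have := f0 x; have := f_le1 x.
  by case: (y == x); rewrite /= ?mulr1n ?mulr0n ler_norml; lra.
rewrite /kernel_mean; under eq_bigr do rewrite mulrBr.
rewrite sumrB -mulr_suml f1 mul1r (bigD1 x)//= eqxx mulr1 big1.
  by rewrite addr0 subrr subr0.
by move=> z /negPf->; rewrite mulr0.
Qed.

End IidSample.

(** * Tail bound for the estimator *)

Section EstimatorTail.
Context {R : realType} {X : finType} {p : nat} {disp : measure_display}
  {Omega : measurableType disp}.
Variables (Pr : probability Omega R) (n m : nat) (q h : X -> R)
  (P : X -> X -> R) (phi : X -> 'cV[R]_p) (theta : 'cV[R]_p)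
  (xs ys : nat -> Omega -> X) (lambda1 lambda2 : R)
  (thetahat : Omega -> 'cV[R]_p).
Hypotheses (n_gt0 : (0 < n)%N) (m_gt0 : (0 < m)%N)
  (kerP : transition_kernel P) (h_gt0 : forall x, 0 < h x)
  (iid_xs : iid_sample Pr n (model_pmf phi theta) xs)
  (chain_ys : markov_chain Pr m q P ys)
  (lambda1_gt0 : 0 < lambda1) (lambda2_gt0 : 0 < lambda2)
  (argmin_thetahat : forall w, is_argmin
    (penalized_loss phi n m h lambda1 lambda2 (xs^~ w) (ys^~ w)) (thetahat w)).

(** Uniqueness of the minimizer makes [thetahat] a function of the two finite samples. *)
Lemma measurable_estimator (A : set 'cV[R]_p) :
  measurable [set w | A (thetahat w)].
Proof.
pose W w := (sample xs n w, sample ys m w).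
have dW : discrete_rv W.
  by apply: discrete_rv_pair; apply: discrete_rv_sample;
    [case: iid_xs|case: chain_ys].
apply: (measurable_determined dW) => w w' eqW /=.
have ex := sample_coord (congr1 fst eqW).
have ey := sample_coord (congr1 snd eqW).
suff -> : thetahat w = thetahat w' by [].
apply: (argmin_penalized_loss_unique lambda1_gt0 lambda2_gt0 m_gt0 h_gt0
  (argmin_thetahat w)).
by rewrite (penalized_loss_ext phi h lambda1 lambda2 ex ey).
Qed.

(** Unless one frequency vector is further than [eps] from its limit in Euclidean norm,
    [estimation_error] applies. As [H] bounds every inverse of [h x], the ratios are then within
    [eps * H] of 1. *)
Lemma estimator_tail (K Cmin B C eps c : R) (s : nat) (psi : X -> X -> R)
    (H := 1 + \sum_x (h x)^-1)
    (Gamma := K * (#|X|%:R * eps + 4 * (eps * H)) + lambda1 + 2 * B * lambda2) :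
  (forall x y, `|psi x y| <= C) ->
  (forall x y, psi x y - kernel_mean P (psi x) y = (y == x)%:R - h x) ->
  0 < K -> (forall x, `|phi x| <= K) -> 0 < Cmin -> `|theta| <= B ->
  (forall u, Cmin * l1norm u ^+ 2 <= s%:R * dot u (model_cov phi theta *m u)) ->
  0 < eps -> eps * H <= 1 / 2 -> K * (24 * s%:R * Gamma) < Cmin / 2 ->
  24 * s%:R * Gamma <= Cmin * c ->
  (Pr [set w | (c < l1norm (thetahat w - theta))%R] <=
   (#|X|%:R * 10 / (n%:R * eps ^+ 2)
    + #|X|%:R * (10 * C ^+ 2) / (m%:R * eps ^+ 2))%:E)%E.
Proof.
move=> psiC psiE K0 phiK Cmin0 thB compat eps0 epsH small le_c.
have e20 : 0 < eps ^+ 2 by rewrite exprn_gt0.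
pose badx := [set w | eps ^+ 2 <
  \sum_x (freq n (xs^~ w) x - model_pmf phi theta x) ^+ 2].
pose bady := [set w | eps ^+ 2 < \sum_x (freq m (ys^~ w) x - h x) ^+ 2].
have freq_measurable k (Z : nat -> Omega -> X) (g : X -> R) :
    (forall i, (i < k)%N -> discrete_rv (Z i)) ->
    measurable [set w | eps ^+ 2 < \sum_x (freq k (Z^~ w) x - g x) ^+ 2].
  move=> dZ; apply: (measurable_sample_determined dZ) => w w' ww' /=.
  by rewrite (freq_ext ww').
have mx : measurable badx by apply: freq_measurable; case: iid_xs.
have my : measurable bady by apply: freq_measurable; case: chain_ys.
have coord_le (g : X -> R) x : \sum_x g x ^+ 2 <= eps ^+ 2 -> `|g x| <= eps.
  move=> g_le; rewrite -ler_sqr ?nnegrE ?(ltW eps0)// real_normK ?num_real//.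
  apply: le_trans g_le; rewrite (bigD1 x)//= lerDl sumr_ge0// => y _.
  exact: sqr_ge0.
have H_ge x : (h x)^-1 <= H.
  rewrite /H (bigD1 x)//= addrCA lerDl addr_ge0// sumr_ge0// => y _.
  by rewrite invr_ge0 ltW.
have subset : [set w | c < l1norm (thetahat w - theta)] `<=` badx `|` bady.
  move=> w /= c_lt; apply: contrapT => /not_orP[/negP okx /negP oky].
  move: okx oky; rewrite -!leNgt => okx oky.
  have x0 : X := xs 0%N w.
  have v_close x : `|freq m (ys^~ w) x / h x - 1| <= eps * H.
    have -> : freq m (ys^~ w) x / h x - 1 = (freq m (ys^~ w) x - h x) / h x.
      by rewrite mulrBl divff ?gt_eqF.
    rewrite normrM (gtr0_norm (_ : 0 < (h x)^-1)) ?invr_gt0//.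
    apply: ler_pM => //; first by rewrite invr_ge0 ltW.
    exact: (coord_le (fun x => freq m (ys^~ w) x - h x)).
  have argmin_w := argmin_thetahat w; rewrite penalized_lossE in argmin_w.
  have := estimation_error x0 K0 phiK Cmin0 thB compat (ltW lambda1_gt0)
    (ltW lambda2_gt0) (fun x => coord_le
      (fun x => freq n (xs^~ w) x - model_pmf phi theta x) x okx)
    v_close epsH argmin_w small.
  move=> /le_trans/(_ le_c); rewrite ler_pM2l// => l1_le.
  by move: c_lt; rewrite ltNge l1_le.
apply: le_trans (_ : Pr (badx `|` bady) <= _)%E.
  apply: le_measure => //; rewrite inE; last exact: measurableU.
  exact: (measurable_estimator [set v | c < l1norm (v - theta)]).
apply: le_trans (measureU2 _ mx my) _; rewrite EFinD; apply: leeD.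
  (* A point of [Omega] supplies the state that [model_pmf_distribution] asks for; without one the
     event is empty. *)
  have [[w _]|noW] := pselect (exists w : Omega, True).
    apply: iid_freq_deviation => //.
    exact: model_pmf_distribution (xs 0%N w).
  rewrite (_ : badx = set0) ?measure0 ?lee_fin.
    by apply: divr_ge0; apply: mulr_ge0 => //; exact: ltW.
  by apply/seteqP; split => // w _; apply: noW; exists w.
exact: freq_deviation chain_ys _ _ _ _ _ _ _ _.
Qed.

End EstimatorTail.

(** * Stochastic orders and the rate *)

Lemma bigOp_littleop {R : realType} {disp : nat -> measure_display}
    {Omega : forall n, measurableType (disp n)}
    (Pr : forall n, probability (Omega n) R) (Z : forall n, Omega n -> R)
    (b : nat -> R) :
  (forall n, (0 < n)%N -> forall c, measurable [set w | c < `|Z n w|]) ->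
  (forall e, 0 < e -> \forall n \near \oo, `|b n| <= e) ->
  bigOp Pr Z b -> littleop Pr Z (fun=> 1).
Proof.
move=> mZ b0 bigZ delta delta0.
pose A n := [set w | delta * `|1 : R| < `|Z n w|].
suff small e : 0 < e -> \forall n \near \oo, (Pr n (A n) <= e%:E)%E.
  apply/fine_cvgP; split.
    have := small 1 ltr01; apply: filterS => n Pr_le.
    rewrite ge0_fin_numE ?measure_ge0//.
    by apply: le_lt_trans Pr_le _; rewrite ltry.
  apply/cvgrPdist_le => e e0; have := small e e0; apply: filterS => n Pr_le.
  rewrite sub0r normrN /= ger0_norm ?fine_ge0 ?measure_ge0//.
  rewrite -lee_fin fineK// ge0_fin_numE ?measure_ge0//.
  by apply: le_lt_trans Pr_le _; rewrite ltry.
move=> e0; have [M M0 PrM] := bigZ e e0.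
have dM0 : 0 < delta / M by rewrite divr_gt0.
near=> n.
have n0 : (0 < n)%N by near: n; exact: nbhs_infty_gt.
apply: le_trans (_ : Pr n [set w | (M * `|b n| < `|Z n w|)%R] <= _)%E.
  apply: le_measure; rewrite ?inE; [exact: mZ|exact: mZ|].
  move=> w /=; rewrite /A/= normr1 mulr1; apply: le_lt_trans.
  rewrite mulrC -ler_pdivlMr//; near: n; exact: b0.
near: n; exact: PrM.
Unshelve. all: by end_near.
Qed.

Section Rate.
Context {R : realType}.
Implicit Types p m n : nat.

Lemma rate_ge0 p m n : 0 <= rate p m n :> R.
Proof.
have lnp : 0 <= ln p%:R :> R.
  by case: p => [|p]; [rewrite ln0|rewrite ln_ge0// ler1n].
by rewrite !addr_ge0// divr_ge0.
Qed.

(** For [p] at most 1 the logarithm is 0, by convention when [p] is 0, and so is the rate. *)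
Lemma rate_gt0_dim p m n : 0 < rate p m n :> R -> (1 < p)%N.
Proof.
move=> rate0; rewrite ltnNge; apply/negP => p1.
have lnp0 : ln p%:R = 0 :> R.
  by case: p p1 {rate0} => [_|[_|//]]; [rewrite ln0|rewrite ln1].
by move: rate0; rewrite /rate lnp0 !mul0r sqrtr0 !addr0 ltxx.
Qed.

(** Each square root is a summand of the rate and ln 2 <= ln p. This bounds the denominators in
    Chebyshev's inequality from below. *)
Lemma rate_sqr_ge p m n : (1 < p)%N -> (0 < n)%N -> (0 < m)%N ->
  ln 2 <= n%:R * rate p m n ^+ 2 :> R /\ ln 2 <= m%:R * rate p m n ^+ 2 :> R.
Proof.
move=> p1 n0 m0.
have ln2p : ln 2 <= ln p%:R :> R.
  by rewrite ler_ln ?posrE ?ler_nat// ltr0n ltnW.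
have lnp : 0 <= ln p%:R :> R by rewrite ln_ge0// ler1n ltnW.
have lnpk k : 0 <= ln p%:R / k%:R :> R by rewrite divr_ge0.
have sq k : (0 < k)%N -> Num.sqrt (ln p%:R / k%:R) <= rate p m n :> R ->
    ln 2 <= k%:R * rate p m n ^+ 2 :> R.
  move=> k0 le_rate; apply: le_trans ln2p _.
  rewrite mulrC -ler_pdivrMr ?ltr0n// -[leLHS]sqr_sqrtr//.
  by rewrite ler_sqr ?nnegrE ?sqrtr_ge0 ?rate_ge0.
split; apply: sq => //; rewrite /rate.
  by rewrite -addrA lerDl addr_ge0.
by rewrite addrAC addrC lerDl addr_ge0.
Qed.

End Rate.

(** * Rate of convergence and consistency *)

Theorem corollaryB1 (R : realType) (r d : nat)
  (P : {ffun 'I_d -> 'I_r} -> {ffun 'I_d -> 'I_r} -> R)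
  (q h : {ffun 'I_d -> 'I_r} -> R)
  (hP : transition_kernel P)
  (hq : distribution_on q)
  (hirr : chain_irreducible P)
  (haper : chain_aperiodic P)
  (hstat : stationary P h)
  (p m : nat -> nat)
  (hm : forall n, (0 < n)%N -> (0 < m n)%N)
  (phi : forall n, {ffun 'I_d -> 'I_r} -> 'cV[R]_(p n))
  (thetastar : forall n, 'cV[R]_(p n))
  (disp : nat -> measure_display)
  (Omega : forall n, measurableType (disp n))
  (Pr : forall n, probability (Omega n) R)
  (xs ys : forall n, nat -> Omega n -> {ffun 'I_d -> 'I_r})
  (hxs : forall n, (0 < n)%N ->
    iid_sample (Pr n) n (model_pmf (phi n) (thetastar n)) (xs n))
  (hys : forall n, (0 < n)%N -> markov_chain (Pr n) (m n) q P (ys n))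
  (lambda1 lambda2 : nat -> R)
  (hlambda1 : forall n, (0 < n)%N -> 0 < lambda1 n)
  (hlambda2 : forall n, (0 < n)%N -> 0 < lambda2 n)
  (thetahat : forall n, Omega n -> 'cV[R]_(p n))
  (hthetahat : forall n, (0 < n)%N -> forall w : Omega n,
    is_argmin
      (penalized_loss (phi n) n (m n) h (lambda1 n) (lambda2 n)
         (fun i => xs n i w) (fun i => ys n i w))
      (thetahat n w))
  (K Cmin B : R)
  (hK : 0 < K) (hCmin : 0 < Cmin) (hB : 0 < B)
  (hphi_cont : forall n, (0 < n)%N ->
    continuous (phi n : discrete_topology {ffun 'I_d -> 'I_r} -> 'cV[R]_(p n)))
  (hphi_bound : forall n, (0 < n)%N -> forall y, `|phi n y| <= K)
  (hcompat : forall n, (0 < n)%N ->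
    (Cmin%:E <=
     ereal_inf [set ereal_inf
         [set compat_factor (l0norm (thetastar n)) zeta T
                (model_cov (phi n) (thetastar n))
         | zeta in [set zeta : R | (1 < zeta)%R]]
       | T in [set: {set 'I_(p n)}]])%E)
  (htheta_bound : forall n, (0 < n)%N -> `|thetastar n| <= B)
  (hs : (fun n => (l0norm (thetastar n))%:R : R^o) =O_\oo (fun=> 1 : R^o))
  (hlambda1_rate : asymp lambda1 (fun n => rate (p n) (m n) n))
  (hlambda12 : asymp lambda1 lambda2)
  (hlambda1_o1 : (lambda1 : nat -> R^o) =o_\oo (fun=> 1 : R^o)) :
  bigOp Pr (fun n w => l1norm (thetahat n w - thetastar n))
    (fun n => (l0norm (thetastar n))%:R * rate (p n) (m n) n)
  /\ littleop Pr (fun n w => l1norm (thetahat n w - thetastar n)) (fun=> 1).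
Proof.
have [[h_ge0 h_sum1] _] := hstat.
have x0 : {ffun 'I_d -> 'I_r}.
  have [x _|X0] := pickP (@predT {ffun 'I_d -> 'I_r}); first exact: x.
  by move: h_sum1; rewrite big_pred0// => /esym/eqP; rewrite oner_eq0.
have h_gt0 := stationary_gt0 hP hirr hstat.
have [psi [C [C0 psiP]]] := poisson_indicators hP hirr hstat.
have psiC x y : `|psi x y| <= C := (psiP x y).1.
have psiE x y : psi x y - kernel_mean P (psi x) y = (y == x)%:R - h x :=
  (psiP x y).2.
have [c1 [c1' [c1_gt0 c1'_gt0 lambda1_rate]]] := hlambda1_rate.
have [c2 [c2' [c2_gt0 c2'_gt0 lambda12]]] := hlambda12.
pose rho n : R := rate (p n) (m n) n.
(* Positivity of [lambda1 n] passes to the rate through [lambda1 n <= c1' * rho n]. *)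
have rho_gt0 n : (0 < n)%N -> 0 < rho n.
  move=> n0; have /andP[_ l1] := lambda1_rate n n0.
  by rewrite -(pmulr_rgt0 _ c1'_gt0); apply: lt_le_trans l1; exact: hlambda1.
have rho_small e : 0 < e -> \forall n \near \oo, rho n <= e.
  move=> e0; have ce0 : 0 < c1 * e by rewrite mulr_gt0.
  move/eqoP: hlambda1_o1 => /(_ _ ce0) l1_small.
  near=> n; have n0 : (0 < n)%N by near: n; exact: nbhs_infty_gt.
  have /andP[l1 _] := lambda1_rate n n0.
  rewrite -(ler_pM2l c1_gt0); apply: le_trans l1 _.
  apply: le_trans (ler_norm _) _.
  rewrite -[leRHS]mulr1 -[X in _ * X]normr1.
  by near: n; exact: l1_small.
move/eqO_exP: hs => [S S0 s_le].
have s_le_near : \forall n \near \oo, (l0norm (thetastar n))%:R <= S :> R.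
  apply: filterS s_le => n; rewrite normr1 mulr1; apply: le_trans.
  exact: ler_norm.
have mZ n : (0 < n)%N -> forall c,
    measurable [set w | c < `|l1norm (thetahat n w - thetastar n)|].
  move=> n0 c; have m0 := hm n n0.
  exact: (measurable_estimator m0 h_gt0 (hxs n n0) (hys n n0) (hlambda1 n n0)
    (hlambda2 n n0) (hthetahat n n0)
    [set v | c < `|l1norm (v - thetastar n)|]).
pose N : R := #|{ffun 'I_d -> 'I_r}|%:R.
pose H : R := 1 + \sum_x (h x)^-1.
have H0 : 0 < H.
  by rewrite /H ltr_pwDl// sumr_ge0// => x _; rewrite invr_ge0 ltW.
have ln20 : 0 < ln 2 :> R by rewrite ln_gt0// ltr1n.
have big : bigOp Pr (fun n w => l1norm (thetahat n w - thetastar n))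
    (fun n => (l0norm (thetastar n))%:R * rate (p n) (m n) n).
  move=> e e0.
  (* Frequencies may deviate by [a * rho n]; this [a] brings the tail bound 10 N (1 + C^2) / (a ln
     2) below [e]. *)
  pose a : R := 1 + 10 * N * (1 + C ^+ 2) / (ln 2 * e).
  have N0 : 0 <= N by rewrite /N.
  have a_ge1 : 1 <= a.
    rewrite /a lerDl divr_ge0//; last by rewrite mulr_ge0// ltW.
    by rewrite mulr_ge0 ?mulr_ge0// addr_ge0// sqr_ge0.
  have a0 : 0 < a := lt_le_trans ltr01 a_ge1.
  (* Collects the constants of [Gamma <= G * rho n], with lambda1 <= c1' rho and lambda2 <= lambda1
     / c2. *)
  pose G : R := K * (N * a + 4 * (a * H)) + c1' + 2 * B * (c1' / c2).
  have G0 : 0 < G.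
    have T1 : 0 <= K * (N * a + 4 * (a * H)).
      by rewrite mulr_ge0 ?(ltW hK)// addr_ge0// !mulr_ge0// ltW.
    have T2 : 0 < 2 * B * (c1' / c2) by rewrite !mulr_gt0 ?invr_gt0.
    exact: addr_gt0 (ltr_wpDl T1 c1'_gt0) T2.
  (* Two thresholds for [rho n]: the first keeps the ratio deviation at most 1/2; the second gives K
     (24 s Gamma) <= Cmin / 4, strictly below Cmin / 2. *)
  have r1 : 0 < 1 / (2 * (a * H)) by rewrite divr_gt0// !mulr_gt0.
  have r2 : 0 < Cmin / (4 * (K * (24 * S * G))) by rewrite divr_gt0// !mulr_gt0.
  exists (24 * G / Cmin); first by rewrite divr_gt0// mulr_gt0.
  near=> n.
  have n0 : (0 < n)%N by near: n; exact: nbhs_infty_gt.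
  have m0 := hm n n0.
  have sS : (l0norm (thetastar n))%:R <= S by near: n; exact: s_le_near.
  have rho0 := rho_gt0 n n0.
  have rho1 : rho n <= 1 / (2 * (a * H)) by near: n; exact: rho_small.
  have rho2 : rho n <= Cmin / (4 * (K * (24 * S * G))).
    by near: n; exact: rho_small.
  move: sS; set s := l0norm (thetastar n) => sS.
  have eps0 : 0 < a * rho n by rewrite mulr_gt0.
  have epsH : a * rho n * H <= 1 / 2.
    move: rho1; rewrite ler_pdivlMr ?mulr_gt0//; lra.
  have /andP[_ l1_le] := lambda1_rate n n0.
  have /andP[l2_le _] := lambda12 n n0.
  set Gamma := K * (N * (a * rho n) + 4 * (a * rho n * H)) + lambda1 n
    + 2 * B * lambda2 n.
  have Gamma_le : Gamma <= G * rho n.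
    have l2_le' : lambda2 n <= c1' / c2 * rho n.
      rewrite mulrAC ler_pdivlMr// mulrC; exact: le_trans l2_le l1_le.
    have B20 : 0 <= 2 * B by rewrite mulr_ge0// ltW.
    have := ler_wpM2l B20 l2_le'; rewrite /Gamma /G.
    move: l1_le; rewrite -/(rho n); move: (c1' / c2) (rho n) => c t; lra.
  have s24 : 0 <= 24 * s%:R :> R by rewrite mulr_ge0.
  have sGamma : 24 * s%:R * Gamma <= 24 * s%:R * (G * rho n).
    by rewrite ler_wpM2l.
  have small : K * (24 * s%:R * Gamma) < Cmin / 2.
    apply: le_lt_trans (_ : K * (24 * S * (G * rho n)) < _).
      rewrite ler_pM2l//; apply: le_trans sGamma _.
      by apply: ler_wpM2r; [rewrite mulr_ge0// ltW|rewrite ler_wpM2l].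
    move: rho2; rewrite ler_pdivlMr ?mulr_gt0//; lra.
  have le_c : 24 * s%:R * Gamma <=
      Cmin * (24 * G / Cmin * `|s%:R * rate (p n) (m n) n|).
    rewrite -/(rho n) ger0_norm; last by rewrite mulr_ge0// ltW.
    apply: le_trans sGamma _.
    rewrite le_eqVlt; apply/orP; left; apply/eqP; field.
    by rewrite gt_eqF.
  have tail := estimator_tail n0 m0 hP h_gt0 (hxs n n0) (hys n n0)
    (hlambda1 n n0) (hlambda2 n n0) (hthetahat n n0) psiC psiE hK
    (hphi_bound n n0) hCmin (htheta_bound n n0)
    (fun u => compat_quadratic u (hcompat n n0)) eps0 epsH small le_c.
  rewrite (_ : [set w | _] = [set w | 24 * G / Cmin *
      `|s%:R * rate (p n) (m n) n| < l1norm (thetahat n w - thetastar n)]).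
    apply: (le_trans tail); rewrite lee_fin.
    have [nrho mrho] := @rate_sqr_ge R _ _ _ (rate_gt0_dim rho0) n0 m0.
    rewrite -/(rho n) in nrho mrho.
    (* Since a >= 1, k (a rho)^2 >= a^2 ln 2 >= a ln 2. *)
    have le_a k : ln 2 <= k * rho n ^+ 2 ->
        (k * (a * rho n) ^+ 2)^-1 <= (ln 2 * a)^-1.
      move=> lnk; have krho0 : 0 < k * rho n ^+ 2 := lt_le_trans ln20 lnk.
      rewrite exprMn mulrCA lef_pV2 ?posrE; last 2 first.
      - by apply: mulr_gt0 => //; exact: exprn_gt0.
      - exact: mulr_gt0.
      rewrite mulrC.
      apply: ler_pM => //; [exact: ltW|exact: ltW|].
      by rewrite expr2 ler_peMl// ltW.
    have C20 := sqr_ge0 C.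
    apply: le_trans (_ : N * 10 / (ln 2 * a) + N * (10 * C ^+ 2) / (ln 2 * a)
        <= _).
      have NC : 0 <= N * (10 * C ^+ 2) by apply: mulr_ge0 => //; exact: mulr_ge0.
      by apply: lerD; apply: ler_wpM2l => //; exact: le_a.
    rewrite -mulrDl ler_pdivrMr ?mulr_gt0//.
    have -> : e * (ln 2 * a) = e * ln 2 + 10 * N * (1 + C ^+ 2).
      rewrite /a; field; rewrite !gt_eqF//.
    have := mulr_gt0 e0 ln20; lra.
  by apply/seteqP; split => w /=; rewrite (ger0_norm (l1norm_ge0 _)).
split=> //.
(* With the sparsity eventually at most [S], the product with [rho n] is at most [e] once
   [rho n <= e / S]. *)
apply: (bigOp_littleop mZ _ big) => e e0.
have eS0 : 0 < e / S by rewrite divr_gt0.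
near=> n; have n0 : (0 < n)%N by near: n; exact: nbhs_infty_gt.
rewrite ger0_norm ?mulr_ge0 ?rate_ge0//.
apply: le_trans (_ : S * (e / S) <= _); last by rewrite mulrC divfK ?gt_eqF.
apply: ler_pM; rewrite ?rate_ge0//; near: n; [exact: s_le_near|exact: rho_small].
Unshelve. all: by end_near.
Qed.
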